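(* Let the tree data $T,k,b_j,\tilde p_j,\alpha_j$ and the spaces $W_{2,\alpha}^s$ with norms $\|\cdot\|_s$ be as defined in the context. For $\varphi_0,\varphi_1\in\mathbb{C}$ let $\mathcal{B}$ be the boundary value problem consisting of the equations $$-y_j''(t)-2i(\mathrm{Im}\,b_j)\,y_j'(t)+|b_j|^2y_j(t)=0,\quad 0<t<1,\quad j\in\mathbb{N},$$ and the conditions $$y_1(0)=\varphi_0;\qquad y_{k_j}(1)=y_j(0),\ j\ge2;\qquad y_j(1)=\varphi_1,\ j\in\mathbb{N}_2;$$ $$y_j'(1)+\beta_jy_j(1)=\sum_{\nu\in V_j}\tilde p_\nu\, y_\nu'(0),\qquad \beta_j:=b_j-\sum_{\nu\in V_j}\tilde p_\nu b_\nu,\qquad j\in\mathbb{N}_1.$$ Then, for all $\varphi_0,\varphi_1\in\mathbb{C}$, the problem $\mathcal{B}$ has a unique solution $y=[y_j]\in W_{2,\alpha}^2$. Moreover, there exists a constant $C$, independent of $\varphi_0$ and $\varphi_1$, such that this solution satisfies $$\|y\|_1\le C(|\varphi_0|+|\varphi_1|).$$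
   Context: Tree. $\mathbb{N}=\{1,2,\dots\}$. Fix an integer $T\ge2$. If $T\ge3$, let $\mathbb{N}_1$ be the set of odd positive integers and $\mathbb{N}_2=\mathbb{N}\setminus\mathbb{N}_1$; if $T=2$, let $\mathbb{N}_1=\{1\}$ and $\mathbb{N}_2=\mathbb{N}\setminus\{1\}$. The infinite rooted tree $\mathcal{T}$ has vertices $v_0,v_1,v_2,\dots$; $v_0$ is the root, the $v_j$ with $j\in\mathbb{N}_1$ are the internal vertices and the $v_j$ with $j\in\mathbb{N}_2\cup\{0\}$ are the boundary vertices. Its edges are $e_j=[v_{k_j},v_j]$, $j\in\mathbb{N}$, where $j\mapsto k_j$ is a map from $\mathbb{N}$ onto $\mathbb{N}_1\cup\{0\}$. Put $V_j=\{\nu\in\mathbb{N}:k_\nu=j\}$ for $j\in\mathbb{N}_1\cup\{0\}$ (indices of the edges leaving $v_j$). The map satisfies: $k_1=0$ and $V_0=\{1\}$; $V_j$ is countably infinite for every $j\in\mathbb{N}_1$; for each $j\in\mathbb{N}$, with $k_j^{\{0\}}=j$ and $k_j^{\{\nu+1\}}=k_{k_j^{\{\nu\}}}$, there is $\nu_j\ge0$ with $k_j^{\{\nu_j\}}=1$; and the tree has exactly $T$ tiers with all leaves other than the root at the last tier, i.e. $\nu_j+1\le T-1$ for $j\in\mathbb{N}_1$ and $\nu_j+1=T$ for $j\in\mathbb{N}_2$. Each edge $e_j$ is parametrized by $t\in[0,1]$, with $t=0$ at $v_{k_j}$ and $t=1$ at $v_j$. Coefficients and weights. Given are $b_1\in\mathbb{C}$,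 a sequence $(\theta_l)_{l\in\mathbb{N}}\subset\mathbb{C}$ with $\sup_l|\theta_l|<\infty$, and numbers $p_l>0$ with $\sum_{l=1}^\infty p_l=1$. For each $j\in\mathbb{N}_1$ enumerate $V_j=\{\nu_{j,l}\}_{l\in\mathbb{N}}$ (without repetition) and set $b_{\nu_{j,l}}=\theta_l$, $\tilde p_{\nu_{j,l}}=p_l$. This defines $b_j$ for all $j\in\mathbb{N}$ and $\tilde p_j$ for all $j\ge2$. Set $\alpha_1=1$ and $\alpha_j=\prod_{\nu=0}^{\nu_j-1}\tilde p_{k_j^{\{\nu\}}}$ for $j\ge2$; equivalently $\alpha_j=\tilde p_j\alpha_{k_j}$ for $j\ge2$. Spaces. For an integer $s\ge0$, $W_{2,\alpha}^s$ is the Hilbert space of tuples $y=[y_j]_{j\in\mathbb{N}}$ of complex-valued functions $y_j\in W_2^s[0,1]$ (Sobolev space; $W_2^0=L_2$) with $\|y\|_s^2=\langle y,y\rangle_s<\infty$, where $\langle y,z\rangle_s=\sum_{j=1}^\infty\alpha_j\langle y_j,z_j\rangle_{W_2^s[0,1]}$. *)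

(* Defs.v *)
From HB Require Import structures.
From mathcomp Require Import all_boot all_order all_algebra.
From mathcomp Require Import all_classical all_reals all_analysis.
From mathcomp Require Export complex.

Set Implicit Arguments.
Unset Strict Implicit.
Unset Printing Implicit Defensive.

Import Order.TTheory GRing.Theory Num.Theory.
Import numFieldNormedType.Exports.

Local Open Scope classical_set_scope.
Local Open Scope ring_scope.

(* Vertices v_0, v_1, ... and edges e_1, e_2, ... are designated by their index
   in nat.  Edges start at 1, so data attached to edges (and the parent map k)
   are total functions on nat whose value at 0 is never used. *)

Definition internal (T j : nat) : bool := if T == 2%N then j == 1%N else odd j.

Definition leaf (T j : nat) : bool := (0 < j)%N && ~~ internal T j.

(* V_j: the indices of the edges leaving v_j *)
Definition children (k : nat -> nat) (j : nat) : set nat :=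
  [set n | (0 < n)%N /\ k n = j].

(* [depth j] is the number nu_j such that the nu_j-th iterate of k at j is 1.
   In [tree_depth], requiring the preceding iterates to be positive says that
   the iteration stays in the domain {1, 2, ...} of k. *)
Record is_tree (T : nat) (k depth : nat -> nat) : Prop := IsTree {
  tree_parent : forall j, (0 < j)%N -> k j = 0%N \/ internal T (k j);
  tree_onto : forall i, i = 0%N \/ internal T i ->
    exists2 j, (0 < j)%N & k j = i;
  tree_root_edge : k 1%N = 0%N;
  tree_children0 : children k 0 = [set 1%N];
  tree_infinite : forall j, internal T j -> infinite_set (children k j);
  tree_depth : forall j, (0 < j)%N ->
    iter (depth j) k j = 1%N /\
    (forall m, (m < depth j)%N -> (0 < iter m k j)%N);
  tree_internal_tier : forall j, internal T j -> ((depth j).+1 <= T.-1)%N;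
  tree_leaf_tier : forall j, leaf T j -> (depth j).+1 = T }.

Section Coefficients.
Variable R : realType.
Local Notation C := R[i].

(* Sequences theta_l, p_l, nu_{j,l} are indexed by l = 0, 1, ... instead of
   l = 1, 2, ...; the value b 1 is arbitrary. *)
Record is_coef (T : nat) (k : nat -> nat) (nu : nat -> nat -> nat)
    (theta : nat -> C) (p : nat -> R) (b : nat -> C) (pt : nat -> R) : Prop :=
  IsCoef {
  coef_theta_bounded : exists M : R, forall l, `|theta l| <= M%:C%C;
  coef_p_gt0 : forall l, 0 < p l;
  coef_p_sum : series p @ \oo --> (1 : R);
  coef_enum : forall j, internal T j -> set_bij setT (children k j) (nu j);
  coef_b : forall j l, internal T j -> b (nu j l) = theta l;
  coef_pt : forall j l, internal T j -> pt (nu j l) = p l }.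

(* For j = 1 the product is empty. *)
Definition alpha (k depth : nat -> nat) (pt : nat -> R) (j : nat) : R :=
  \prod_(m < depth j) pt (iter m k j).

End Coefficients.

Section Sobolev.
Variable R : realType.
Local Notation C := R[i].
Local Notation mu := (@lebesgue_measure R).

(* C^1 functions with compact support in ]0, 1[ *)
Definition test_function (phi : R -> R) : Prop :=
  [/\ forall t, derivable phi t 1, continuous (derive1 phi) &
      exists a b : R, [/\ 0 < a, b < 1 & forall t, t \notin `[a, b] -> phi t = 0]].

Definition weak_derivative_real (f g : R -> R) : Prop :=
  forall phi, test_function phi ->
    \int[mu]_(t in `[0, 1]) (f t * derive1 phi t) =
    - \int[mu]_(t in `[0, 1]) (g t * phi t).

Definition weak_derivative (f g : R -> C) : Prop :=
  weak_derivative_real (fun t => complex.Re (f t)) (fun t => complex.Re (g t)) /\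
  weak_derivative_real (fun t => complex.Im (f t)) (fun t => complex.Im (g t)).

Definition sqmod (z : C) : R := complex.Re z ^+ 2 + complex.Im z ^+ 2.

Definition sqnormL2 (f : R -> C) : \bar R :=
  (\int[mu]_(t in `[0%R, 1%R]) (sqmod (f t))%:E)%E.

Definition inL2 (f : R -> C) : Prop :=
  [/\ measurable_fun `[0 : R, 1] (fun t : R => complex.Re (f t)),
      measurable_fun `[0 : R, 1] (fun t : R => complex.Im (f t)) &
      (sqnormL2 f < +oo)%E].

Definition continuous01 (f : R -> C) : Prop :=
  {within `[0, 1], continuous (fun t => complex.Re (f t))} /\
  {within `[0, 1], continuous (fun t => complex.Im (f t))}.

(* An element f of W_2^s[0,1], given together with its weak derivatives:
   [f k] is f^(k).  For k < s, f^(k) lies in W_2^1[0,1], and [f k] is its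
   continuous representative, so that [f k 0] and [f k 1] are the boundary
   values.  Only the values on [0, 1] of [f k] for k <= s are meaningful. *)
Record sobolev (s : nat) := Sobolev {
  sobolev_der :> nat -> R -> C;
  sobolev_L2 : forall k, (k <= s)%N -> inL2 (sobolev_der k);
  sobolev_cont : forall k, (k < s)%N -> continuous01 (sobolev_der k);
  sobolev_weak : forall k, (k < s)%N ->
    weak_derivative (sobolev_der k) (sobolev_der k.+1) }.

(* The squared norm in W_{2,w}^s, for s <= r. *)
Definition sqnormW (w : nat -> R) (s r : nat) (y : nat -> sobolev r) : \bar R :=
  (\sum_(1 <= j <oo) ((w j)%:E * \sum_(m < s.+1) sqnormL2 (y j m)))%E.

Definition normW (w : nat -> R) (s r : nat) (y : nat -> sobolev r) : \bar R :=
  sqrte (sqnormW w s y).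

Definition inW (w : nat -> R) (s : nat) (y : nat -> sobolev s) : Prop :=
  (normW w s y < +oo)%E.

(* Equality as tuples indexed by {1, 2, ...} of continuous functions on [0, 1] *)
Definition same_tuple (s : nat) (y z : nat -> sobolev s) : Prop :=
  forall j t, (0 < j)%N -> t \in `[0, 1] -> y j 0%N t = z j 0%N t.

End Sobolev.

Section BoundaryValueProblem.
Local Open Scope complex_scope.
Variable R : realType.
Local Notation C := R[i].
Local Notation mu := (@lebesgue_measure R).

Definition series_cvg (u : nat -> C) (l : C) : Prop :=
  series (fun n => complex.Re (u n)) @ \oo --> complex.Re l /\
  series (fun n => complex.Im (u n)) @ \oo --> complex.Im l.

Definition series_sum (u : nat -> C) : C :=
  limn (series (fun n => complex.Re (u n))) +i*
  limn (series (fun n => complex.Im (u n))).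

(* Sums over V_j are taken along the enumeration nu j. *)
Definition beta (nu : nat -> nat -> nat) (b : nat -> C) (pt : nat -> R)
    (j : nat) : C :=
  b j - series_sum (fun l => (pt (nu j l))%:C * b (nu j l)).

(* Since y_j'' is only in L_2, the equation holds almost everywhere.  The last
   condition includes the convergence of the series on its right-hand side. *)
Record solves_B (T : nat) (k : nat -> nat) (nu : nat -> nat -> nat)
    (b : nat -> C) (pt : nat -> R) (phi0 phi1 : C)
    (y : nat -> sobolev R 2) : Prop := SolvesB {
  B_equation : forall j, (0 < j)%N ->
    {ae mu, forall t : R, t \in `]0, 1[ ->
      - y j 2%N t - 2 * (0 +i* 1) * (complex.Im (b j))%:C * y j 1%N t
        + `|b j| ^+ 2 * y j 0%N t = 0};
  B_root : y 1%N 0%N 0 = phi0;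
  B_continuity : forall j, (2 <= j)%N -> y (k j) 0%N 1 = y j 0%N 0;
  B_leaf : forall j, leaf T j -> y j 0%N 1 = phi1;
  B_kirchhoff : forall j, internal T j ->
    series_cvg (fun l => (pt (nu j l))%:C * y (nu j l) 1%N 0)
      (y j 1%N 1 + beta nu b pt j * y j 0%N 1) }.

End BoundaryValueProblem.

(* Main.v *)
(** The edge equation says (y' + b y)' = conj(b) (y' + b y).  Hence on an edge
    y is determined by x = y(0) and w = (y' + b y)(0), with
    y(t) = exp (- b t) (x + w * int_0^t exp (2 (Re b) s) ds), and the conditions
    at an internal vertex v_j read
    (y_j' + b_j y_j)(1) = sum_nu pt_nu (y_nu' + b_nu y_nu)(0).
    All leaves are at the same tier and carry the same value phi1, and the
    coefficients of the edges leaving a vertex do not depend on the vertex.  So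
    elimination of the unknowns from the leaves up gives on each edge
    w = a * phi1 - s * x, where a and s depend only on the coefficient of the
    edge and on the number of tiers below it.  As s >= 0, no elimination step
    divides by zero, and a, s are uniformly bounded.  Starting from y_1(0) = phi0
    one then recovers y from the root down, which gives existence, uniqueness and
    a uniform pointwise bound; the norm bound follows since the weights alpha_j
    of each tier add up to at most 1. *)

Require Import Defs.
From mathcomp Require Import all_boot all_order all_algebra.
From mathcomp Require Import all_classical all_reals all_analysis.
From mathcomp Require Import measurable_realfun ring lra.
Import Order.TTheory GRing.Theory Num.Theory.
Import numFieldNormedType.Exports.
Local Open Scope classical_set_scope.
Local Open Scope ring_scope.

(** * Weak derivatives on the unit interval *)

Section WeakDerivative.
Set Implicit Arguments.
Unset Strict Implicit.
Variable R : realType.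
Local Notation mu := (@lebesgue_measure R).
Implicit Types f g h F : R -> R.

Lemma derivable_oo_continuous01 F :
  {within `[0, 1], continuous F} ->
  (forall t : R, t \in `]0, 1[ -> derivable F t 1) ->
  derivable_oo_LRcontinuous F 0 1.
Proof.
move=> cF dF; have /(continuous_within_itvP _ ltr01) [_ F0 F1] := cF.
by split.
Qed.

(** Integration by parts on [0, 1]: the boundary terms drop out because a test function vanishes at
    0 and at 1. *)
Lemma weak_derivative_classical F g :
  {within `[0, 1], continuous F} -> {within `[0, 1], continuous g} ->
  (forall t : R, t \in `]0, 1[ -> is_derive t 1 F (g t)) ->
  weak_derivative_real F g.
Proof.
move=> cF cg dF phi [dphi cphi [a [b [a0 b1 phi0]]]].
have Lphi : derivable_oo_LRcontinuous phi 0 1.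
  apply: derivable_oo_continuous01 => //.
  by apply: derivable_within_continuous => t _; apply: dphi.
have LF : derivable_oo_LRcontinuous F 0 1.
  by apply: derivable_oo_continuous01 cF _ => t /dF [].
have F'g : {in `]0, 1[, derive1 F =1 g}.
  by move=> t /dF [_ Ft]; rewrite derive1E Ft.
rewrite (Rintegration_by_parts ltr01 cg LF F'g (continuous_subspaceT cphi) Lphi
  (fun _ _ => erefl)).
by rewrite !phi0 ?in_itv /= ?negb_and -?ltNge ?a0 ?b1 ?orbT // !mulr0 subrr sub0r.
Qed.

Lemma is_derive0_const01 F :
  {within `[0, 1], continuous F} ->
  (forall t : R, t \in `]0, 1[ -> is_derive t 1 F 0) ->
  forall t : R, t \in `[0, 1] -> F t = F 0.
Proof.
move=> cF dF t; rewrite in_itv /= => /andP[t0 t1].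
move: t0; rewrite le_eqVlt => /predU1P[<- //|t0].
have cFt : {within `[0, t], continuous F}.
  by apply: continuous_subspaceW cF; apply: subset_itvl; rewrite bnd_simp.
have dFt (x : R) : x \in `]0, t[ -> is_derive x 1 F ((fun=> 0) x).
  move=> xt; apply: dF; move: xt; rewrite !in_itv /= => /andP[-> xt].
  exact: lt_le_trans xt t1.
have [c _ /eqP] := MVT t0 dFt cFt.
by rewrite mul0r subr_eq0 => /eqP.
Qed.

(** * Explicit C^1 test functions from second differences *)

Definition ramp (x : R) : R := Num.max x 0.
Definition sqramp (x : R) : R := ramp x ^+ 2 / 2.

Lemma continuous_ramp : continuous ramp.
Proof. by move=> x; apply: continuous_max => //; exact: cvg_cst. Qed.

Lemma is_derive_sqramp (x : R) : is_derive x 1 sqramp (ramp x).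
Proof.
have [x0|x0|->] := ltrgtP x 0.
- rewrite /ramp max_r; last exact: ltW.
  apply: (@near_eq_is_derive _ _ _ (cst 0)).
  + near=> y; rewrite /sqramp /ramp max_r ?expr0n ?mul0r //.
    by apply: ltW; near: y; exact: lt_nbhsl.
- rewrite /ramp max_l; last exact: ltW.
  apply: (@near_eq_is_derive _ _ _ (fun y : R => y ^+ 2 / 2)).
  + near=> y; rewrite /sqramp /ramp max_l //.
    by apply: ltW; near: y; exact: lt_nbhsr.
  + by apply: is_derive_eq; rewrite /GRing.scale /=; lra.
(* At the junction of the two branches the difference quotient is h / 2 or 0, hence at most |h| in
   absolute value. *)
- have lim0 : (fun h : R => h^-1 *: (sqramp (h *:
  1 + 0) - sqramp 0)) @ (0:R)^' --> (0 : R).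
    apply/cvgrPdist_le => e e0; near=> h.
    have h0 : h != 0 by near: h; exact: nbhs_dnbhs_neq.
    have he : `|h| <= e.
      near: h; exact: dnbhs0_le.
    rewrite sub0r normrN addr0 /sqramp /ramp maxxx expr0n mul0r subr0.
    rewrite /GRing.scale /= mulr1; apply: le_trans he.
    have [hp|hn] := leP 0 h.
      rewrite ger0_norm.
        by rewrite expr2 !mulrA mulVf // mul1r ger0_norm // ler_pdivrMr // ler_peMr
          // ler1n.
      by rewrite mulr_ge0 ?invr_ge0 // divr_ge0 // sqr_ge0.
    by rewrite expr0n mul0r mulr0 normr0.
  rewrite /ramp maxxx; apply: DeriveDef.
    by apply/cvg_ex; exists 0.
  exact: cvg_lim lim0.
Unshelve. all: by end_near.
Qed.


Lemma Rintegral_FTC01 F f :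
  {within `[0, 1], continuous F} -> {within `[0, 1], continuous f} ->
  (forall t : R, t \in `]0, 1[ -> is_derive t 1 F (f t)) ->
  \int[mu]_(t in `[0, 1]) f t = F 1 - F 0.
Proof.
move=> cF cf dF; rewrite /Rintegral (@continuous_FTC2 _ f F) //.
- by apply: derivable_oo_continuous01 => // t /dF.
- by move=> t /dF ?; rewrite derive1E derive_val.
Qed.

Lemma integrable01 f : {within `[0, 1], continuous f} ->
  mu.-integrable `[0, 1] (EFin \o f).
Proof. by move=> cf; apply: continuous_compact_integrable => //;
  exact: segment_compact. Qed.

(* Piecewise linear, supported in [-d, d], and its primitive, which is 0 on
   the left of -d and d^2 on the right of d. *)
Definition hat (d x : R) : R := ramp (x + d) - 2 * ramp x + ramp (x - d).
Definition step (d x : R) : R := sqramp (x + d) - 2 * sqramp x + sqramp (x - d).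

Lemma is_derive_step (d c x : R) :
  is_derive x 1 (fun u => step d (u - c)) (hat d (x - c)).
Proof.
rewrite /step /hat.
have D (e : R) : is_derive x 1 (fun u => sqramp (u - c + e)) (ramp (x - c + e)).
  have dsq := is_derive_sqramp (x - c + e).
  have := @is_derive1_comp _ sqramp (fun u => u - c + e) x _ 1 dsq.
  rewrite mulr1; apply.
  by apply: is_derive_eq; rewrite subr0 addr0.
have := D d; have := D (- d); have := D 0.
rewrite addr0 => /[swap] D1 /[swap] D2.
under eq_fun do rewrite addr0.
move=> D0; exact: is_derive_eq.
Qed.

Lemma continuous_hat (d c : R) : continuous (fun x => hat d (x - c)).
Proof.
move=> x; rewrite /hat.
have C (e : R) : {for x, continuous (fun u => ramp (u - c + e))}.
  apply: (@continuous_comp _ _ _ (fun u => u - c + e) ramp).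
    by apply: cvgD; [apply: cvgB; [exact: cvg_id|exact: cvg_cst]|exact: cvg_cst].
  exact: continuous_ramp.
apply: cvgD; last exact: C.
apply: cvgB; first exact: C.
apply: cvgM; first exact: cvg_cst.
apply: (@continuous_comp _ _ _ (fun u => u - c) ramp).
  by apply: cvgB; [exact: cvg_id|exact: cvg_cst].
exact: continuous_ramp.
Qed.

Lemma hat_ge0 (d x : R) : 0 <= d -> 0 <= hat d x.
Proof.
move=> d0; rewrite /hat /ramp.
by have [|] := leP (x + d) 0; have [|] := leP x 0; have [|] := leP (x - d) 0; lra.
Qed.

Lemma hat_eq0 (d x : R) : 0 <= d -> d <= `|x| -> hat d x = 0.
Proof.
move=> d0; rewrite /hat /ramp; have [x0|x0] := leP 0 x => dx.
  by move: dx; rewrite ger0_norm // => dx; rewrite !max_l; lra.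
by move: dx; rewrite ltr0_norm // => dx; rewrite !max_r; lra.
Qed.

Lemma step_left (d x : R) : 0 <= d -> x <= - d -> step d x = 0.
Proof.
by move=> d0 xd; rewrite /step /sqramp /ramp !max_r ?expr0n ?mul0r ?mulr0 ?subrr
  ?add0r //; lra.
Qed.

Lemma step_right (d x : R) : 0 <= d -> d <= x -> step d x = d ^+ 2.
Proof.
by move=> d0 xd; rewrite /step /sqramp /ramp !max_l; lra.
Qed.

(* If [h t < h s], test with phi' = hat at s minus hat at t, which is a C^1
   test function since both hats have the same integral. *)
Lemma weak_derivative0_le h : {within `[0, 1], continuous h} ->
  weak_derivative_real h (fun=> 0) ->
  forall s t : R, s \in `]0, 1[ -> t \in `]0, 1[ -> h s <= h t.
Proof.
move=> ch wh s t s01 t01; rewrite leNgt; apply/negP => hts.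
have /(continuous_within_itvP _ ltr01) [ch' _ _] := ch.
(* Two levels cutting the gap in thirds, [h t < e < c < h s]; by continuity [h] stays above [c] near
   [s] and below [e] near [t]. *)
pose c := (2 * h s + h t) / 3; pose e := (h s + 2 * h t) / 3.
have [d [d0 sd td]] : exists d : R, [/\ 0 < d,
    (forall x, `|x - s| < d -> (x \in `]0, 1[) /\ c < h x) &
    (forall x, `|x - t| < d -> (x \in `]0, 1[) /\ h x < e)].
  have S : \forall x \near s, (x \in `]0, 1[) /\ c < h x.
    near=> x; split; first by near: x; exact: near_in_itvoo.
    near: x; apply: (cvgr_gt (h s)); [exact: ch' | rewrite /c; lra].
  have T : \forall x \near t, (x \in `]0, 1[) /\ h x < e.
    near=> x; split; first by near: x; exact: near_in_itvoo.
    near: x; apply: (cvgr_lt (h t)); [exact: ch' | rewrite /e; lra].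
  have /nbhs_ballP [d1 /= d10 B1] := S; have /nbhs_ballP [d2 /= d20 B2] := T.
  exists (Num.min d1 d2); split; first by rewrite lt_min d10.
    by move=> x; rewrite lt_min => /andP[xs _]; apply: B1; rewrite /ball /= distrC.
  by move=> x; rewrite lt_min => /andP[_ xs]; apply: B2; rewrite /ball /= distrC.
(* Half of [d], so that the closed supports of both hats lie in the open balls of radius [d], and
   thus inside ]0, 1[. *)
pose r := d / 2.
have r0 : 0 < r by rewrite divr_gt0.
have rd : r < d by rewrite /r; lra.
have [s1 s2] : r < s /\ s < 1 - r.
  have [] := sd (s - r); first by rewrite addrAC subrr sub0r normrN gtr0_norm.
  have [] := sd (s + r); first by rewrite addrAC subrr add0r gtr0_norm.
  by rewrite !in_itv /= => /andP[_ +] _ /andP[+ _] _; split; lra.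
have [t1 t2] : r < t /\ t < 1 - r.
  have [] := td (t - r); first by rewrite addrAC subrr sub0r normrN gtr0_norm.
  have [] := td (t + r); first by rewrite addrAC subrr add0r gtr0_norm.
  by rewrite !in_itv /= => /andP[_ +] _ /andP[+ _] _; split; lra.
pose phi (x : R) := step r (x - s) - step r (x - t).
have dphi (x : R) : is_derive x 1 phi (hat r (x - s) - hat r (x - t)).
  by apply: is_deriveB; exact: is_derive_step.
have phi'E : derive1 phi = fun x => hat r (x - s) - hat r (x - t).
  by apply/funext => x; rewrite derive1E; have ? := dphi x; rewrite derive_val.
have chat (u v : R) : continuous (fun x => u * hat r (x - s) - v * hat r (x - t)).
  by move=> x; apply: cvgB; (apply: cvgM; [exact: cvg_cst|exact: continuous_hat]).
have cphi' : continuous (derive1 phi).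
  rewrite phi'E; rewrite [X in continuous X](_ : _ = fun x =>
    1 * hat r (x - s) - 1 * hat r (x - t)) //.
  by apply/funext => x; rewrite !mul1r.
have tphi : test_function phi.
  split; [by move=> x; have [] := dphi x|exact: cphi'|].
  exists (Num.min (s - r) (t - r)), (Num.max (s + r) (t + r)); split.
  - by rewrite lt_min !subr_gt0 s1.
  - by rewrite gt_max; apply/andP; split; lra.
  move=> x; rewrite in_itv /= negb_and -!ltNge lt_min gt_max /phi.
  by case/orP => /andP[x1 x2];
    [rewrite !step_left|rewrite !step_right]; rewrite ?subrr //; lra.
have := wh _ tphi; rewrite [X in _ = - X](_ : _ = 0); last first.
  by rewrite (_ : (fun _ => _) = cst 0) ?Rintegral_cst ?mul0r //; apply/funext => x;
    rewrite mul0r.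
rewrite oppr0 => I0.
(* This combination of hats lies below [h] times the derivative of [phi], whose integral is 0, yet
   its own integral [(c - e) * r ^+ 2] is positive. *)
have I1 : \int[mu]_(x in `[0, 1]) (c * hat r (x - s) - e * hat r (x - t)) =
  (c - e) * r ^+ 2.
  pose psi (x : R) := c * step r (x - s) - e * step r (x - t).
  have dpsi (x : R) : is_derive x 1 psi (c * hat r (x - s) - e * hat r (x - t)).
    have ? := is_derive_step r s x; have ? := is_derive_step r t x.
    exact: is_derive_eq.
  have cpsi : {within `[0, 1], continuous psi}.
    by apply: derivable_within_continuous => x _; have ? := dpsi x.
  rewrite (Rintegral_FTC01 cpsi (continuous_subspaceT (chat c e)) (fun x _ => dpsi x)).
  by rewrite /psi !(@step_left _ (0 - _)) ?(@step_right _ (1 - _)); lra.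
have : (c - e) * r ^+ 2 <= 0.
  rewrite -I0 -I1; apply: le_Rintegral => //.
  - by apply: integrable01; exact/continuous_subspaceT.
  - apply: integrable01 => x; apply: continuousM; first exact: ch.
    exact/continuous_subspaceT.
  move=> x _; rewrite phi'E mulrBr lerB //.
    have [rx|xr] := leP r `|x - s|; first by rewrite hat_eq0 ?mulr0 ?(ltW r0).
    by rewrite ler_wpM2r ?hat_ge0 ?(ltW r0) //; apply: ltW;
      have [] := sd x (lt_trans xr rd).
  have [rx|xr] := leP r `|x - t|; first by rewrite hat_eq0 ?mulr0 ?(ltW r0).
  by rewrite ler_wpM2r ?hat_ge0 ?(ltW r0) //; apply: ltW;
    have [] := td x (lt_trans xr rd).
have ce : 0 < c - e by rewrite /c /e; lra.
by rewrite leNgt mulr_gt0 // exprn_gt0.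
Unshelve. all: by end_near.
Qed.

(** The preceding inequality holds for both orders of the two points, so [h] is constant on ]0, 1[;
    continuity carries this to the endpoints. *)
Lemma weak_derivative0_const h : {within `[0, 1], continuous h} ->
  weak_derivative_real h (fun=> 0) -> forall t : R, t \in `[0, 1] -> h t = h 0.
Proof.
move=> ch wh; apply: is_derive0_const01 => // t t01.
have le := weak_derivative0_le ch wh.
apply: (@near_eq_is_derive _ _ _ (cst (h t))).
by near=> x; apply/eqP; rewrite /= eq_le !le //; near: x; exact: near_in_itvoo.
Unshelve. all: by end_near.
Qed.

(** Du Bois-Reymond argument: for the primitive [G] of [g], the difference f - G has weak derivative
    0, hence is constant, and [f] inherits the classical derivative of [G]. *)
Lemma continuous_weak_derivative f g :
  {within `[0, 1], continuous f} -> {within `[0, 1], continuous g} ->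
  weak_derivative_real f g ->
  forall t : R, t \in `]0, 1[ -> is_derive t 1 f (g t).
Proof.
move=> cf cg wfg; pose G x : R := \int[mu]_(t in `[0, x]) g t.
have ig := integrable01 cg.
have cG : {within `[0, 1], continuous G} by exact: parameterized_integral_continuous.
have /(continuous_within_itvP _ ltr01) [cg' _ _] := cg.
have dG (t : R) : t \in `]0, 1[ -> is_derive t 1 G (g t).
  move=> t01; move: (t01); rewrite in_itv /= => /andP[t0 t1].
  have [|dGt Gt] := @continuous_FTC1_closed _ g 0 t 1 t1 ig t0; first exact: cg'.
  by rewrite derive1E in Gt; exact: DeriveDef dGt Gt.
have wG := weak_derivative_classical cG cg dG.
have cfG : {within `[0, 1], continuous (fun x => f x - G x)}.
  by move=> x; apply: continuousB; [exact: cf|exact: cG].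
have E : forall t : R, t \in `[0, 1] -> f t - G t = f 0 - G 0.
  apply: (weak_derivative0_const cfG) => phi tphi.
  have [dphi cphi' _] := tphi.
  have cphi : {within `[0, 1], continuous phi}.
    by apply: derivable_within_continuous => t _; exact: dphi.
  have iM F : {within `[0, 1], continuous F} ->
      mu.-integrable `[0, 1] (EFin \o (fun t => F t * derive1 phi t)).
    move=> cF; apply: integrable01 => x; apply: continuousM; first exact: cF.
    exact/continuous_subspaceT.
  rewrite (_ : (fun t => _ * _) = (fun t => f t * derive1 phi t - G t * derive1 phi t)).
    rewrite RintegralB ?iM // wfg // wG // subrr.
    by rewrite (_ : (fun _ => _) = cst 0) ?Rintegral_cst ?mul0r ?oppr0 //;
      apply/funext => x; rewrite mul0r.
  by apply/funext => t; rewrite mulrBl.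
move=> t t01; apply: (@near_eq_is_derive _ _ _ (fun x => (f 0 - G 0) + G x)).
  near=> x; rewrite -(E x) ?subrK //.
  apply: subset_itv_oo_cc; near: x; exact: near_in_itvoo.
have ? := dG t t01; by apply: is_derive_eq; rewrite add0r mul1r.
Unshelve. all: by end_near.
Qed.

End WeakDerivative.

(** * Componentwise calculus of complex functions *)

Section ComplexCalculus.
Set Implicit Arguments.
Unset Strict Implicit.
Variable R : realType.
Local Open Scope complex_scope.
Local Notation C := R[i].
Local Notation nrm := (@Normc.normc R).
Implicit Types (f g : R -> C) (a b x w z d : C).

Lemma cReD a b : complex.Re (a + b) = complex.Re a + complex.Re b.
Proof. by case: a b => [? ?] [? ?]. Qed.

Lemma cImD a b : complex.Im (a + b) = complex.Im a + complex.Im b.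
Proof. by case: a b => [? ?] [? ?]. Qed.

Lemma cReM a b :
  complex.Re (a * b) = complex.Re a * complex.Re b - complex.Im a * complex.Im b.
Proof. by case: a b => [? ?] [? ?]. Qed.

Lemma cImM a b :
  complex.Im (a * b) = complex.Re a * complex.Im b + complex.Im a * complex.Re b.
Proof. by case: a b => [? ?] [? ?]. Qed.

Lemma complex_eq a b : complex.Re a = complex.Re b -> complex.Im a =
  complex.Im b -> a = b.
Proof. by case: a b => [? ?] [? ?] /= -> ->. Qed.

(** Together with |b|^2 = b conj(b), this turns the edge equation into a polynomial identity in b
    and conj(b), within reach of [ring]. *)
Lemma sub_conjc b : b - b^*%C = 2 * (0 +i* 1) * (complex.Im b)%:C.
Proof.
by case: b => [r s]; apply: complex_eq;
  rewrite /= !(mul0r, mulr0, mul1r, addr0, add0r, subr0);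
  rewrite ?subrr ?opprK; lra.
Qed.

Lemma add_conjc b : b + b^*%C = (2 * complex.Re b)%:C.
Proof. by case: b => [r s]; apply: complex_eq => /=; lra. Qed.

Lemma nrm_ge0 z : 0 <= nrm z.
Proof. by case: z => a b; exact: sqrtr_ge0. Qed.

Lemma nrmD a b : nrm (a + b) <= nrm a + nrm b.
Proof. exact: le_normcD. Qed.

Lemma nrmM a b : nrm (a * b) = nrm a * nrm b.
Proof. exact: Normc.normcM. Qed.

Lemma nrmN a : nrm (- a) = nrm a.
Proof. exact: normcN. Qed.

Lemma nrm_real (r : R) : nrm r%:C = `|r|.
Proof. by rewrite /= expr0n /= addr0 sqrtr_sqr. Qed.

Lemma nrm_conjc a : nrm a^*%C = nrm a.
Proof. by case: a => r s /=; rewrite sqrrN. Qed.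

Lemma Re_normc z : complex.Re `|z| = nrm z.
Proof. by case: z. Qed.

Lemma norm_nrm z : `|z| = (nrm z)%:C.
Proof. by case: z. Qed.

Lemma nrm_Re z : `|complex.Re z| <= nrm z.
Proof.
by case: z => a b /=; rewrite -sqrtr_sqr ler_wsqrtr // lerDl sqr_ge0.
Qed.

Lemma nrm_Im z : `|complex.Im z| <= nrm z.
Proof.
by case: z => a b /=; rewrite -sqrtr_sqr ler_wsqrtr // lerDr sqr_ge0.
Qed.

Lemma sqmod_nrm z : sqmod z = nrm z ^+ 2.
Proof. by case: z => a b /=; rewrite sqr_sqrtr // addr_ge0 ?sqr_ge0. Qed.

Lemma is_derive_ext (u v : R -> R) (t c d : R) : is_derive t 1 u c ->
  u =1 v -> c = d -> is_derive t 1 v d.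
Proof. by move=> du /funext <- <-. Qed.

Lemma continuous_ext (u v : R -> R) : {within `[0, 1], continuous u} ->
  u =1 v -> {within `[0, 1], continuous v}.
Proof. by move=> cu /funext <-. Qed.

Definition is_cderive (t : R) f d : Prop :=
  is_derive t 1 (fun s => complex.Re (f s)) (complex.Re d) /\
  is_derive t 1 (fun s => complex.Im (f s)) (complex.Im d).

Lemma is_cderive_cst t a : is_cderive t (fun=> a) 0.
Proof. by split; exact: is_derive_cst. Qed.

Lemma is_cderiveD t f g a b : is_cderive t f a -> is_cderive t g b ->
  is_cderive t (fun s => f s + g s) (a + b).
Proof.
move=> [f1 f2] [g1 g2]; split.
  by apply: is_derive_ext (is_deriveD f1 g1) _ _ => [s|]; rewrite cReD.
by apply: is_derive_ext (is_deriveD f2 g2) _ _ => [s|]; rewrite cImD.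
Qed.

Lemma is_cderiveM t f g a b : is_cderive t f a -> is_cderive t g b ->
  is_cderive t (fun s => f s * g s) (a * g t + f t * b).
Proof.
move=> [f1 f2] [g1 g2]; split.
  apply: is_derive_ext (is_deriveB (is_deriveM f1 g1) (is_deriveM f2 g2)) _ _ => [s|].
    by rewrite cReM.
  by rewrite /GRing.scale /= cReD !cReM; lra.
apply: is_derive_ext (is_deriveD (is_deriveM f1 g2) (is_deriveM f2 g1)) _ _ => [s|].
  by rewrite cImM.
by rewrite /GRing.scale /= cImD !cImM; lra.
Qed.

Lemma is_cderive_eq t f a b : is_cderive t f a -> a = b -> is_cderive t f b.
Proof. by move=> ? <-. Qed.

Lemma is_cderiveZ t a f b : is_cderive t f b ->
  is_cderive t (fun s => a * f s) (a * b).
Proof.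
move=> df; apply: is_cderive_eq (is_cderiveM (is_cderive_cst t a) df) _.
by rewrite mul0r add0r.
Qed.

Lemma withinD01 (u v : R -> R) :
  {within `[0, 1], continuous u} -> {within `[0, 1], continuous v} ->
  {within `[0, 1], continuous (fun t => u t + v t)}.
Proof. by move=> cu cv t; apply: continuousD; [exact: cu|exact: cv]. Qed.

Lemma withinB01 (u v : R -> R) :
  {within `[0, 1], continuous u} -> {within `[0, 1], continuous v} ->
  {within `[0, 1], continuous (fun t => u t - v t)}.
Proof. by move=> cu cv t; apply: continuousB; [exact: cu|exact: cv]. Qed.

Lemma withinM01 (u v : R -> R) :
  {within `[0, 1], continuous u} -> {within `[0, 1], continuous v} ->
  {within `[0, 1], continuous (fun t => u t * v t)}.
Proof. by move=> cu cv t; apply: continuousM; [exact: cu|exact: cv]. Qed.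

Lemma continuous01D f g : continuous01 f -> continuous01 g ->
  continuous01 (fun t => f t + g t).
Proof.
move=> [f1 f2] [g1 g2]; split.
  exact: continuous_ext (withinD01 f1 g1) (fun t => esym (cReD _ _)).
exact: continuous_ext (withinD01 f2 g2) (fun t => esym (cImD _ _)).
Qed.

Lemma continuous01M f g : continuous01 f -> continuous01 g ->
  continuous01 (fun t => f t * g t).
Proof.
move=> [f1 f2] [g1 g2]; split.
  apply: continuous_ext (fun t => esym (cReM _ _)).
  exact: withinB01 (withinM01 f1 g1) (withinM01 f2 g2).
apply: continuous_ext (fun t => esym (cImM _ _)).
exact: withinD01 (withinM01 f1 g2) (withinM01 f2 g1).
Qed.

Lemma continuous01_cst a : continuous01 (fun=> a).
Proof. by split=> t; exact: cst_continuous. Qed.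

Lemma is_cderive_continuous01 f f' :
  (forall t, is_cderive t f (f' t)) -> continuous01 f.
Proof.
by move=> df; split; apply: derivable_within_continuous => t _; have [? ?] := df t.
Qed.

Lemma is_cderive0_const01 f : continuous01 f ->
  (forall t : R, t \in `]0, 1[ -> is_cderive t f 0) ->
  forall t : R, t \in `[0, 1] -> f t = f 0.
Proof.
move=> [cf1 cf2] df t t01; apply: complex_eq.
  by apply: (is_derive0_const01 cf1) => // s /df [].
by apply: (is_derive0_const01 cf2) => // s /df [].
Qed.

Lemma continuous_weak_cderivative f g : continuous01 f -> continuous01 g ->
  weak_derivative f g -> forall t : R, t \in `]0, 1[ -> is_cderive t f (g t).
Proof.
move=> [f1 f2] [g1 g2] [w1 w2] t t01.
by split; [exact: (continuous_weak_derivative f1 g1)|exact: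
  (continuous_weak_derivative f2 g2)].
Qed.

Lemma cderivative_weak f g : continuous01 f -> continuous01 g ->
  (forall t : R, t \in `]0, 1[ -> is_cderive t f (g t)) -> weak_derivative f g.
Proof.
move=> [f1 f2] [g1 g2] df; split.
  by apply: weak_derivative_classical => // t /df [].
by apply: weak_derivative_classical => // t /df [].
Qed.

(** The function exp (b t), written out by components to match the componentwise notion of
    derivative. *)
Definition cexp b (t : R) : C :=
  (expR (complex.Re b * t) * cos (complex.Im b * t)) +i*
  (expR (complex.Re b * t) * sin (complex.Im b * t)).

Lemma cexp0 b : cexp b 0 = 1.
Proof. by rewrite /cexp !mulr0 expR0 cos0 sin0 mulr0 mulr1. Qed.

Lemma cexpD a b t : cexp (a + b) t = cexp a t * cexp b t.
Proof.
apply: complex_eq; rewrite ?cReM ?cImM /= cReD cImD !mulrDl expRD ?cosD ?sinD; ring.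
Qed.

Lemma cexp_real (r t : R) : cexp r%:C t = (expR (r * t))%:C.
Proof. by rewrite /cexp /= mul0r cos0 sin0 mulr0 mulr1. Qed.

Lemma cexpN b t : cexp b t * cexp (- b) t = 1.
Proof. by rewrite -cexpD subrr (cexp_real 0) mul0r expR0. Qed.

Lemma nrm_cexp b t : nrm (cexp b t) = expR (complex.Re b * t).
Proof.
rewrite /= !exprMn -mulrDr cos2Dsin2 mulr1 sqrtr_sqr ger0_norm //; exact: expR_ge0.
Qed.

Lemma is_derive_lin (c t : R) : is_derive t 1 (fun s : R => c * s) c.
Proof. by apply: is_derive_eq; rewrite /GRing.scale /= mulr1. Qed.

Lemma is_cderive_cexp b t : is_cderive t (cexp b) (b * cexp b t).
Proof.
set r := complex.Re b; set s := complex.Im b.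
have lr := is_derive_lin r t; have ls := is_derive_lin s t.
have dE : is_derive t 1 (fun u => expR (r * u)) (r * expR (r * t)).
  by rewrite mulrC; apply: is_derive1_comp.
have dC : is_derive t 1 (fun u => cos (s * u)) (- s * sin (s * t)).
  by rewrite mulNr mulrC -mulNr; apply: is_derive1_comp.
have dS : is_derive t 1 (fun u => sin (s * u)) (s * cos (s * t)).
  by rewrite mulrC; apply: is_derive1_comp.
split; rewrite /= -/r -/s; apply: is_derive_eq;
  rewrite /GRing.scale /= ?cReM ?cImM /= -/r -/s; ring.
Qed.

End ComplexCalculus.

(** * The equation on one edge *)

Section EdgeEquation.
Set Implicit Arguments.
Unset Strict Implicit.
Variable R : realType.
Local Open Scope complex_scope.
Local Notation C := R[i].
Local Notation mu := (@lebesgue_measure R).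
Local Notation nrm := (@Normc.normc R).
Implicit Types (f g : R -> C) (a b x w z d : C).

(* The integral of exp (r s) for s in [0, t]. *)
Definition prim_exp (r t : R) : R := if r == 0 then t else (expR (r * t) - 1) / r.

Lemma is_derive_prim_exp (r t : R) : is_derive t 1 (prim_exp r) (expR (r * t)).
Proof.
rewrite /prim_exp; have [->|r0] := eqVneq r 0.
  by rewrite mul0r expR0; exact: is_derive_id.
have lr := is_derive_lin r t.
have dE : is_derive t 1 (fun u => expR (r * u)) (r * expR (r * t)).
  by rewrite mulrC; apply: is_derive1_comp.
by apply: is_derive_eq; rewrite /GRing.scale /= mulr0 add0r subr0; field.
Qed.

Lemma prim_exp0 (r : R) : prim_exp r 0 = 0.
Proof. by rewrite /prim_exp mulr0 expR0 subrr mul0r; case: ifP. Qed.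

(** By the mean value theorem [prim_exp r t] equals exp (r c) t for some c between 0 and t, and |r
    c| is at most m. *)
Lemma prim_exp_bounds (r m t : R) : `|r| <= m -> t \in `[0, 1] ->
  expR (- m) * t <= prim_exp r t <= expR m.
Proof.
rewrite ler_norml in_itv /= => /andP[mr rm] /andP[t0 t1].
have m0 : 0 <= m by lra.
move: t0; rewrite le_eqVlt => /predU1P[<-|t0].
  by rewrite prim_exp0 mulr0 lexx expR_ge0.
have [||c] := @MVT R (prim_exp r) (fun s => expR (r * s)) 0 t t0.
- by move=> s _; exact: is_derive_prim_exp.
- by apply: derivable_within_continuous => s _; have ? := is_derive_prim_exp r s.
rewrite in_itv /= prim_exp0 !subr0 => /andP[c0 ct] ->.
have mc : m * c <= m by rewrite ler_piMr //; lra.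
have rc1 : - m * c <= r * c by rewrite ler_pM2r.
have rc2 : r * c <= m * c by rewrite ler_pM2r.
rewrite ler_pM2r // ler_expR; apply/andP; split; first lra.
apply: (@le_trans _ _ (expR (r * c))); last by rewrite ler_expR; lra.
by rewrite ler_piMr // expR_ge0.
Qed.

Lemma prim_exp1_gt0 (r : R) : 0 < prim_exp r 1.
Proof.
have i1 : (1 : R) \in `[0, 1] by rewrite in_itv /= ler01 lexx.
have /andP[+ _] := prim_exp_bounds (lexx `|r|) i1.
by apply: lt_le_trans; rewrite mulr1 expR_gt0.
Qed.

(* The solution of the edge equation with y(0) = x and (y' + b y)(0) = w, and
   its first two derivatives: the equation says that y' + b y is a multiple of
   exp (conj(b) t). *)
Definition edge b x w (t : R) : C :=
  cexp (- b) t * (x + w * (prim_exp (2 * complex.Re b) t)%:C).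
Definition edge1 b x w (t : R) : C := - b * edge b x w t + w * cexp b^*%C t.
Definition edge2 b x w (t : R) : C :=
  - b * edge1 b x w t + w * (b^*%C * cexp b^*%C t).

Lemma edge_0 b x w : edge b x w 0 = x.
Proof. by rewrite /edge cexp0 prim_exp0 mulr0 addr0 mul1r. Qed.

Lemma edge1_0 b x w : edge1 b x w 0 = w - b * x.
Proof. by rewrite /edge1 edge_0 cexp0 mulr1 mulNr addrC. Qed.

Lemma cexpN_prim b (t : R) :
  cexp (- b) t * (expR (2 * complex.Re b * t))%:C = cexp b^*%C t.
Proof.
by rewrite -cexp_real -cexpD -add_conjc addrA [- b + b]addrC subrr add0r.
Qed.

Lemma is_cderive_prim_exp (r t : R) :
  is_cderive t (fun s => (prim_exp r s)%:C) (expR (r * t))%:C.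
Proof. by split; [exact: is_derive_prim_exp|exact: is_derive_cst]. Qed.

Lemma is_cderive_edge b x w (t : R) : is_cderive t (edge b x w) (edge1 b x w t).
Proof.
apply: is_cderive_eq.
  apply: is_cderiveM; first exact: is_cderive_cexp.
  apply: is_cderiveD; first exact: is_cderive_cst.
  apply: is_cderiveZ; exact: is_cderive_prim_exp.
by rewrite /edge1 /edge -cexpN_prim; ring.
Qed.

Lemma is_cderive_edge1 b x w (t : R) : is_cderive t (edge1 b x w) (edge2 b x w t).
Proof.
apply: is_cderiveD; first by apply: is_cderiveZ; exact: is_cderive_edge.
by apply: is_cderiveZ; exact: is_cderive_cexp.
Qed.

Lemma continuous01_edge b x w : continuous01 (edge b x w).
Proof. by apply: is_cderive_continuous01 => t; exact: is_cderive_edge. Qed.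

Lemma continuous01_edge1 b x w : continuous01 (edge1 b x w).
Proof. by apply: is_cderive_continuous01 => t; exact: is_cderive_edge1. Qed.

Lemma continuous01_edge2 b x w : continuous01 (edge2 b x w).
Proof.
apply: continuous01D; first by apply: continuous01M (continuous01_edge1 _ _ _);
  exact: continuous01_cst.
apply: continuous01M; first exact: continuous01_cst.
apply: continuous01M; first exact: continuous01_cst.
by apply: is_cderive_continuous01 => t; exact: is_cderive_cexp.
Qed.

Lemma edge_equation b x w (t : R) :
  - edge2 b x w t - 2 * (0 +i* 1) * (complex.Im b)%:C * edge1 b x w t
    + `|b| ^+ 2 * edge b x w t = 0.
Proof. by rewrite -sub_conjc sqr_normc /edge2 {2}/edge1 /edge1; ring. Qed.

(* [y' + b y] times [exp (- conj(b) t)] is constant, say [w], and then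
   [exp (b t) y - w * prim_exp t] is constant. *)
Lemma edge_unique b (z0 z1 : R -> C) : continuous01 z0 -> continuous01 z1 ->
  (forall t : R, t \in `]0, 1[ -> is_cderive t z0 (z1 t)) ->
  (forall t : R, t \in `]0, 1[ -> is_cderive t z1
     (`|b| ^+ 2 * z0 t - 2 * (0 +i* 1) * (complex.Im b)%:C * z1 t)) ->
  let w := z1 0 + b * z0 0 in
  forall t : R, t \in `[0, 1] -> z0 t = edge b (z0 0) w t /\ z1 t = edge1 b (z0 0) w t.
Proof.
move=> c0 c1 d0 d1 w.
have cE a : continuous01 (cexp a).
  by apply: is_cderive_continuous01 => t; exact: is_cderive_cexp.
have W (t : R) : t \in `[0, 1] -> z1 t + b * z0 t = w * cexp b^*%C t.
  move=> t01; pose u s := cexp (- b^*%C) s * (z1 s + b * z0 s).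
  have : u t = u 0.
    apply: is_cderive0_const01 t01.
      apply: continuous01M (cE _) _; apply: continuous01D => //.
      by apply: continuous01M => //; exact: continuous01_cst.
    move=> s s01; apply: is_cderive_eq.
      apply: is_cderiveM; first exact: is_cderive_cexp.
      apply: is_cderiveD; first exact: d1.
      by apply: is_cderiveZ; exact: d0.
    by rewrite -sub_conjc sqr_normc; ring.
  rewrite /u cexp0 mul1r -/w => <-.
  by rewrite mulrAC [_ * cexp _ _]mulrC cexpN mul1r.
have Z (t : R) : t \in `[0, 1] -> z0 t = edge b (z0 0) w t.
  move=> t01; pose u s := cexp b s * z0 s + - w * (prim_exp (2 * complex.Re b) s)%:C.
  have : u t = u 0.
    apply: is_cderive0_const01 t01.
      apply: continuous01D; first exact: continuous01M.
      apply: continuous01M; first exact: continuous01_cst.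
      by apply: is_cderive_continuous01 => ?; exact: is_cderive_prim_exp.
    move=> s s01; apply: is_cderive_eq.
      apply: is_cderiveD.
        by apply: is_cderiveM; [exact: is_cderive_cexp|exact: d0].
      by apply: is_cderiveZ; exact: is_cderive_prim_exp.
    transitivity (cexp b s * (z1 s + b * z0 s) - w * (expR (2 * complex.Re b * s))%:C).
      by ring.
    rewrite W ?(subset_itv_oo_cc s01) // -cexpN_prim.
    transitivity (w * (expR (2 * complex.Re b * s))%:C * (cexp b s * cexp (- b) s -
      1)); first by ring.
    by rewrite cexpN subrr mulr0.
  rewrite {2}/u cexp0 prim_exp0 mul1r mulr0 addr0 => <-.
  rewrite /edge /u.
  transitivity (cexp b t * cexp (- b) t * z0 t); last by ring.
  by rewrite cexpN mul1r.
move=> t t01; split; first exact: Z.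
by rewrite /edge1 -W // -Z //; ring.
Qed.

End EdgeEquation.

(** * Edge solutions in the Sobolev space *)

Section EdgeSobolev.
Set Implicit Arguments.
Unset Strict Implicit.
Variable R : realType.
Local Open Scope complex_scope.
Local Notation C := R[i].
Local Notation mu := (@lebesgue_measure R).
Local Notation nrm := (@Normc.normc R).
Implicit Types (f g : R -> C) (a b x w z d : C).

Lemma within_measurable01 (h : R -> R) : {within `[0, 1], continuous h} ->
  measurable_fun `[0 : R, 1] h.
Proof. by move=> ch; apply: subspace_continuous_measurable_fun => //. Qed.

(** Weak derivatives integrate over the closed interval, whereas the edge equation is stated on the
    open one; the two endpoints are set aside here and later discarded as null sets. *)
Lemma ae_itvoo_itvcc (P : R -> Prop) :
  {ae mu, forall t : R, t \in `]0, 1[ -> P t} ->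
  {ae mu, forall t : R, t \in `[0, 1] -> t != 0 -> t != 1 -> P t}.
Proof.
apply: filterS; first exact: (ae_filter_ringOfSetsType mu).
move=> t + /[!in_itv] /= /andP[t0 t1] tn0 tn1; apply.
by rewrite in_itv /= !lt_neqAle t0 t1 eq_sym tn0 tn1.
Qed.

Lemma ae_neq (c : R) : {ae mu, forall t : R, t != c}.
Proof.
exists [set c]; split => //; first exact: lebesgue_measure_set1.
by move=> t /= /negP; rewrite negbK => /eqP.
Qed.

Lemma weak_derivative_real_ae (f g h : R -> R) :
  measurable_fun `[0 : R, 1] g -> measurable_fun `[0 : R, 1] h ->
  {ae mu, forall t : R, t \in `]0, 1[ -> g t = h t} ->
  weak_derivative_real f g -> weak_derivative_real f h.
Proof.
move=> mg mh gh wfg phi tphi; rewrite wfg //; congr (- _).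
have mphi : measurable_fun `[0 : R, 1] phi.
  apply: within_measurable01; apply: derivable_within_continuous => t _.
  by have [dphi _ _] := tphi; exact: dphi.
rewrite /Rintegral; congr fine; apply: ae_eq_integral => //.
- by apply/measurable_EFinP; exact: measurable_funM.
- by apply/measurable_EFinP; exact: measurable_funM.
have := ae_neq 1; have := ae_neq 0; have := ae_itvoo_itvcc gh.
apply: filterS3; first exact: (ae_filter_ringOfSetsType mu).
move=> t tgh t0 t1 t01.
by rewrite tgh.
Qed.

(** Regularity: the equation makes y'' equal almost everywhere to the continuous function [g], so y
    and y' are classically differentiable on ]0, 1[ and [edge_unique] applies. *)
Lemma sobolev_edge b (y : sobolev R 2) :
  {ae mu, forall t : R, t \in `]0, 1[ ->
      - y 2%N t - 2 * (0 +i* 1) * (complex.Im b)%:C * y 1%N t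
        + `|b| ^+ 2 * y 0%N t = 0} ->
  let w := y 1%N 0 + b * y 0%N 0 in
  forall t : R, t \in `[0, 1] ->
    y 0%N t = edge b (y 0%N 0) w t /\ y 1%N t = edge1 b (y 0%N 0) w t.
Proof.
move=> yE.
have c0 := @sobolev_cont _ _ y 0%N isT; have c1 := @sobolev_cont _ _ y 1%N isT.
pose g t := `|b| ^+ 2 * y 0%N t - 2 * (0 +i* 1) * (complex.Im b)%:C * y 1%N t.
have cg : continuous01 g.
  rewrite (_ : g = fun t =>
    `|b| ^+ 2 * y 0%N t + - (2 * (0 +i* 1) * (complex.Im b)%:C) * y 1%N t).
    by apply: continuous01D; apply: continuous01M => //; exact: continuous01_cst.
  by apply/funext => t; rewrite mulNr.
have gE : {ae mu, forall t : R, t \in `]0, 1[ -> y 2%N t = g t}.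
  move: yE; apply: filterS; first exact: (ae_filter_ringOfSetsType mu).
  move=> t yt t01; have := yt t01.
  by rewrite /g => /eqP; rewrite -addrA addrC subr_eq0 => /eqP <-; rewrite addrC.
have [mR mI _] := @sobolev_L2 _ _ y 2%N isT.
apply: edge_unique => //.
  exact: continuous_weak_cderivative (@sobolev_weak _ _ y 0%N isT).
apply: continuous_weak_cderivative => //.
have [wR wI] := @sobolev_weak _ _ y 1%N isT; have [gR gI] := cg.
split.
  apply: (weak_derivative_real_ae mR (within_measurable01 gR)) wR.
  move: gE; apply: filterS; first exact: (ae_filter_ringOfSetsType mu).
  by move=> t gt t01; rewrite gt.
apply: (weak_derivative_real_ae mI (within_measurable01 gI)) wI.
move: gE; apply: filterS; first exact: (ae_filter_ringOfSetsType mu).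
by move=> t gt t01; rewrite gt.
Qed.

Lemma sqnormL2_le f (K : R) :
  measurable_fun `[0 : R, 1] (fun t : R => complex.Re (f t)) ->
  measurable_fun `[0 : R, 1] (fun t : R => complex.Im (f t)) ->
  (forall t : R, t \in `[0, 1] -> nrm (f t) <= K) -> (sqnormL2 f <= (K ^+ 2)%:E)%E.
Proof.
move=> mR mI fK; have i0 : (0 : R) \in `[0, 1] by rewrite in_itv /= lexx ler01.
have H : (sqnormL2 f <= \int[mu]_(t in `[0%R, 1%R]) (cst (K ^+ 2)%:E t))%E.
  apply: ge0_le_integral => //.
  - by move=> t _; rewrite lee_fin sqmod_nrm sqr_ge0.
  - apply/measurable_EFinP; apply: measurable_funD; exact: measurable_funX.
  by move=> t t01; rewrite lee_fin sqmod_nrm lerXn2r ?nnegrE ?nrm_ge0 ?fK //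
    (le_trans _ (fK _ i0)) ?nrm_ge0.
apply: (le_trans H);
  rewrite integral_cst //= lebesgue_measure_itv /= lte_fin ltr01 oppr0 adde0 mule1.
exact: lexx.
Qed.

Lemma nrm_cexp_le b (M t : R) : nrm b <= M -> t \in `[0, 1] ->
  nrm (cexp b t) <= expR M.
Proof.
move=> bM; rewrite nrm_cexp ler_expR in_itv /= => /andP[t0 t1].
apply: le_trans bM; apply: le_trans (nrm_Re b).
have [r0|r0] := leP 0 (complex.Re b); first by rewrite ger0_norm // ler_piMr.
by apply: le_trans (normr_ge0 _); rewrite mulr_le0_ge0 // ltW.
Qed.

Lemma normr_2Re_le b (M : R) : nrm b <= M -> `|2 * complex.Re b| <= 2 * M.
Proof.
move=> bM; rewrite normrM ger0_norm // ler_pM2l //.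
exact: le_trans (nrm_Re b) bM.
Qed.

(** Indices above 2 fall back on [edge2]; [sobolev R 2] constrains only the indices up to 2. *)
Definition edge_der (m : nat) b x w : R -> C :=
  match m with 0 => edge b x w | 1 => edge1 b x w | _ => edge2 b x w end.

(** The constant depends on [M] alone, so a single one serves all edges of the tree. *)
Lemma edge_der_bounded (M : R) : exists2 K : R, 0 <= K &
  forall m b x w (t : R), nrm b <= M -> t \in `[0, 1] ->
    nrm (edge_der m b x w t) <= K * (nrm x + nrm w).
Proof.
have [M0|M0] := leP 0 M; last first.
  exists 0 => // m b x w t bM; have := nrm_ge0 b; by move: (le_lt_trans bM M0);
    rewrite ltNge => /negP.
(* [e] bounds the exponentials and [expR (2 * M)] bounds [prim_exp]; [K1] and [K2] follow the
   recursive shape of [edge1] and [edge2]. *)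
pose e := expR M; pose K0 := e * (1 + expR (2 * M)).
pose K1 := M * K0 + e; pose K2 := M * K1 + M * e.
have e0 : 0 <= e by exact: expR_ge0.
have K00 : 0 <= K0 by rewrite mulr_ge0 // addr_ge0 ?expR_ge0.
have K10 : 0 <= K1 by rewrite addr_ge0 ?mulr_ge0.
have K20 : 0 <= K2 by rewrite addr_ge0 ?mulr_ge0.
exists (K0 + K1 + K2) => [|m b x w t bM t01]; first by apply: addr_ge0 => //;
  apply: addr_ge0.
set N := nrm x + nrm w.
have N0 : 0 <= N by rewrite addr_ge0 ?nrm_ge0.
have wN : nrm w <= N by rewrite lerDr nrm_ge0.
have xN : nrm x <= N by rewrite lerDl nrm_ge0.
have B0 : nrm (edge b x w t) <= K0 * N.
  rewrite /edge nrmM -mulrA ler_pM ?nrm_ge0 //.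
    by apply: nrm_cexp_le; rewrite ?nrmN.
  apply: le_trans (nrmD _ _) _; rewrite [leRHS]mulrDl mul1r lerD //.
  rewrite nrmM nrm_real mulrC ler_pM ?nrm_ge0 ?normr_ge0 //.
  have /andP[p1 p2] := prim_exp_bounds (normr_2Re_le bM) t01.
  rewrite ger0_norm // (le_trans _ p1) // mulr_ge0 ?expR_ge0 //.
  by move: t01; rewrite in_itv /= => /andP[].
have cb : nrm (cexp b^*%C t) <= e by apply: nrm_cexp_le; rewrite ?nrm_conjc.
have B1 : nrm (edge1 b x w t) <= K1 * N.
  apply: le_trans (nrmD _ _) _;
    rewrite (nrmM (- b)) (nrmM w) ?(nrmM b^*%C) nrmN [leRHS]mulrDl lerD //.
    by rewrite -mulrA ler_pM ?nrm_ge0.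
  by rewrite mulrC ler_pM ?nrm_ge0.
have B2 : nrm (edge2 b x w t) <= K2 * N.
  apply: le_trans (nrmD _ _) _;
    rewrite (nrmM (- b)) (nrmM w) ?(nrmM b^*%C) nrmN [leRHS]mulrDl lerD //.
    by rewrite -mulrA ler_pM ?nrm_ge0.
  by rewrite mulrC ler_pM ?mulr_ge0 ?nrm_ge0 // ler_pM ?nrm_ge0 // nrm_conjc.
case: m => [|[|m]]; [apply: le_trans B0 _|apply: le_trans B1 _|apply: le_trans B2 _];
  apply: ler_wpM2r => //; lra.
Qed.

Lemma continuous01_edge_der m b x w : continuous01 (edge_der m b x w).
Proof.
by case: m => [|[|m]]; [exact: continuous01_edge|exact: continuous01_edge1|exact:
  continuous01_edge2].
Qed.

Lemma inL2_edge_der m b x w : inL2 (edge_der m b x w).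
Proof.
have [cR cI] := continuous01_edge_der m b x w.
split; [exact: within_measurable01|exact: within_measurable01|].
have [K _ HK] := edge_der_bounded (nrm b).
apply: (@le_lt_trans _ _ ((K * (nrm x + nrm w)) ^+ 2)%:E); last exact: ltry.
by apply: sqnormL2_le => [||t t01];
  [exact: within_measurable01|exact: within_measurable01|exact: HK].
Qed.

Lemma weak_derivative_edge_der m b x w : (m < 2)%N ->
  weak_derivative (edge_der m b x w) (edge_der m.+1 b x w).
Proof.
move=> m2; apply: cderivative_weak; try exact: continuous01_edge_der.
by case: m m2 => [|[|]] // _ t _; [exact: is_cderive_edge|exact: is_cderive_edge1].
Qed.

Definition edge_sobolev b x w : sobolev R 2 :=
  @Sobolev R 2 (fun m => edge_der m b x w)
    (fun m _ => inL2_edge_der m b x w)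
    (fun m _ => continuous01_edge_der m b x w)
    (fun m m2 => weak_derivative_edge_der b x w m2).

End EdgeSobolev.

(** * Complex series *)

Section ComplexSeries.
Set Implicit Arguments.
Unset Strict Implicit.
Variable R : realType.
Local Open Scope complex_scope.
Local Notation C := R[i].
Local Notation nrm := (@Normc.normc R).
Implicit Types (u v : nat -> C) (a b c l m : C).

Lemma series_cvg_unique u l m : series_cvg u l -> series_cvg u m -> l = m.
Proof.
move=> [uR uI] [vR vI]; apply: complex_eq.
  exact: (cvg_unique _ uR vR).
exact: (cvg_unique _ uI vI).
Qed.

Lemma series_cvgD u v l m : series_cvg u l -> series_cvg v m ->
  series_cvg (fun n => u n + v n) (l + m).
Proof.
move=> [uR uI] [vR vI]; rewrite /series_cvg cReD cImD; split.
  rewrite (_ : series _ = series (fun n => complex.Re (u n)) + series (fun n =>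
    complex.Re (v n))).
    exact: cvgD.
  apply/funext => N; rewrite /series /= -[RHS]big_split /=.
  by apply: eq_bigr => n _; rewrite cReD.
rewrite (_ : series _ = series (fun n => complex.Im (u n)) + series (fun n =>
  complex.Im (v n))).
  exact: cvgD.
apply/funext => N; rewrite /series /= -[RHS]big_split /=.
by apply: eq_bigr => n _; rewrite cImD.
Qed.

Lemma series_cvgZ c u l : series_cvg u l -> series_cvg (fun n => c * u n) (c * l).
Proof.
move=> [uR uI]; rewrite /series_cvg cReM cImM.
have S (f g : nat -> R) (r s x y : R) : series f @ \oo --> x -> series g @ \oo --> y ->
    series (fun n => r * f n + s * g n) @ \oo --> r * x + s * y.
  move=> fx gy; rewrite (_ : series _ = fun N => r * series f N + s * series g N).
    by apply: cvgD; apply: cvgMr.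
  apply/funext => N; rewrite /series /= big_split /=; congr (_ + _);
    by rewrite mulr_sumr.
split.
  rewrite -mulNr (_ : (fun n => _) = fun n =>
    complex.Re c * complex.Re (u n) + (- complex.Im c) * complex.Im (u n)).
    exact: S.
  by apply/funext => n; rewrite cReM mulNr.
rewrite (_ : (fun n => _) = fun n =>
  complex.Re c * complex.Im (u n) + complex.Im c * complex.Re (u n)).
  exact: S.
by apply/funext => n; rewrite cImM.
Qed.

(** Absolute convergence by comparison with the series of [K * p n]. *)
Lemma weighted_series_cvg (p : nat -> R) (f : nat -> R) (K : R) :
  (forall n, 0 < p n) -> cvgn (series p) -> (forall n, `|f n| <= K) ->
  cvgn (series (fun n => p n * f n)).
Proof.
move=> p0 cp fK; apply: normed_cvg.
apply: (@series_le_cvg _ _ (fun n => K * p n)) => [n|n|n|].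
- exact: normr_ge0.
- by rewrite mulr_ge0 ?(ltW (p0 n)) // (le_trans _ (fK n)).
- by rewrite /= normrM mulrC (gtr0_norm (p0 n)) ler_wpM2r // ltW.
- by apply: is_cvg_seriesZ.
Qed.

Lemma weighted_series_sum (p : nat -> R) u (K : R) :
  (forall n, 0 < p n) -> cvgn (series p) -> (forall n, nrm (u n) <= K) ->
  series_cvg (fun n => (p n)%:C * u n) (series_sum (fun n => (p n)%:C * u n)).
Proof.
move=> p0 cp uK; split=> /=.
  rewrite (_ : (fun n => complex.Re _) = fun n => p n * complex.Re (u n)).
    by apply: weighted_series_cvg => // n; apply: le_trans (nrm_Re _) (uK n).
  by apply/funext => n; rewrite cReM /= mul0r subr0.
rewrite (_ : (fun n => complex.Im _) = fun n => p n * complex.Im (u n)).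
  by apply: weighted_series_cvg => // n; apply: le_trans (nrm_Im _) (uK n).
by apply/funext => n; rewrite cImM /= mul0r addr0.
Qed.

Lemma series_cvg_real (f : nat -> R) (x : R) : series f @ \oo --> x ->
  series_cvg (fun n => (f n)%:C) x%:C.
Proof.
move=> fx; split => //=.
rewrite (_ : series _ = cst 0); first exact: cvg_cst.
by apply/funext => N; rewrite /series /= big1.
Qed.

End ComplexSeries.

(** * Elimination from the leaves up *)

Section DirichletToNeumann.
Set Implicit Arguments.
Unset Strict Implicit.
Variable R : realType.
Local Open Scope complex_scope.
Local Notation C := R[i].
Local Notation nrm := (@Normc.normc R).
Variables (theta : nat -> C) (p : nat -> R).
Implicit Types (a b c x w : C).

Let rt b : R := expR (2 * complex.Re b).
Let E b : R := prim_exp (2 * complex.Re b) 1.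

(* If [n] tiers lie below an edge with coefficient [b], and all leaves carry
   the value phi, then (y' + b y)(0) = (dtn n).1 b * phi - (dtn n).2 b * y(0)
   on that edge.  Since theta and p do not depend on the parent vertex, these
   coefficients depend on [n] and [b] only. *)
Fixpoint dtn (n : nat) : (C -> C) * (C -> R) :=
  match n with
  | 0%N => (fun b => cexp b 1 / (prim_exp (2 * complex.Re b) 1)%:C,
            fun b => (prim_exp (2 * complex.Re b) 1)^-1)
  | m.+1 =>
    let A := series_sum (fun l => (p l)%:C * (dtn m).1 (theta l)) in
    let B := limn (series (fun l => p l * (dtn m).2 (theta l))) in
    let D b := expR (2 * complex.Re b) + prim_exp (2 * complex.Re b) 1 * B in
    (fun b => cexp b 1 * A / (D b)%:C, fun b => B / D b)
  end.

(** The quantities [A] and [B] of [dtn]: if the edges leaving a vertex have [n] tiers below them and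
    the vertex has value X, the weighted sum of (y' + b y)(0) over these edges is [vertex_source n]
    phi - [vertex_slope n] X. *)
Definition vertex_source n : C := series_sum (fun l => (p l)%:C * (dtn n).1 (theta l)).
Definition vertex_slope n : R := limn (series (fun l => p l * (dtn n).2 (theta l))).

(** The leaf condition exp (- b) (x + w E) = phi is solved for w, with [E b] positive. *)
Lemma edge_leaf b x w phi :
  edge b x w 1 = phi <-> w = (dtn 0).1 b * phi - ((dtn 0).2 b)%:C * x.
Proof.
have E0 : (E b)%:C != 0 by rewrite fmorph_eq0 gt_eqF // prim_exp1_gt0.
have eK := cexpN b 1.
rewrite /edge /= fmorphV -/(E b); split=> [<-|->].
  transitivity ((cexp b 1 * cexp (- b) 1 * (x + w * (E b)%:C) - x) / (E b)%:C);
    last by field.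
  by rewrite eK; field.
transitivity (cexp b 1 * cexp (- b) 1 * phi); last by rewrite eK mul1r.
by field.
Qed.

(** The left side is the condition at the lower vertex, since (y' + b y)(1) = w exp (conj(b)). After
    multiplication by exp b the coefficient of w is rt + E B, which is positive because B >= 0. *)
Lemma edge_internal n b x w phi : 0 <= vertex_slope n ->
  w * cexp b^*%C 1 = vertex_source n * phi - (vertex_slope n)%:C * edge b x w 1 <->
  w = (dtn n.+1).1 b * phi - ((dtn n.+1).2 b)%:C * x.
Proof.
move=> B0 /=; rewrite -/(vertex_source n) -/(vertex_slope n).
set A := vertex_source n; set B := vertex_slope n.
have D0 : (rt b)%:C + (E b)%:C * B%:C != 0.
  rewrite -rmorphM -rmorphD fmorph_eq0 gt_eqF // ltr_wpDr ?expR_gt0 //.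
  by rewrite mulr_ge0 // ltW // prim_exp1_gt0.
have eK := cexpN b 1.
rewrite /edge -cexpN_prim mulr1 -/(rt b) -/(E b) fmorph_div /= rmorphD rmorphM /=.
split=> H.
  apply: (mulIf D0).
  transitivity (cexp b 1 * cexp (- b) 1 * (w * (rt b)%:C) + w * (E b)%:C * B%:C).
    by rewrite eK; ring.
  transitivity (cexp b 1 * (w * (cexp (- b) 1 * (rt b)%:C)) + w * (E b)%:C * B%:C);
    first by ring.
  rewrite H.
  transitivity (cexp b 1 * A * phi - B%:C * x * (cexp b 1 * cexp (- b) 1) + w * (E
    b)%:C * B%:C * (1 - cexp b 1 * cexp (- b) 1)); first by ring.
  by rewrite eK; field.
transitivity (cexp (- b) 1 * (w * ((rt b)%:C + (E b)%:C * B%:C)) - B%:C * cexp (- b)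
  1 * w * (E b)%:C); first by ring.
rewrite {1}H.
transitivity (cexp b 1 * cexp (- b) 1 * A * phi - B%:C * cexp (- b) 1 * (x + w * (E
  b)%:C)).
  by field.
by rewrite eK; ring.
Qed.

Hypothesis p_gt0 : forall l, 0 < p l.
Hypothesis p_cvg : cvgn (series p).
Variable M : R.
Hypothesis thetaM : forall l, nrm (theta l) <= M.

Lemma nrm_source_le (D : R) b (L : R) a : nrm b <= L -> expR (- (2 * L)) <= D ->
  nrm (cexp b 1 * a / D%:C) <= expR L * nrm a * expR (2 * L).
Proof.
move=> bL De; have D0 : 0 < D := lt_le_trans (expR_gt0 _) De.
rewrite !nrmM -fmorphV nrm_real gtr0_norm ?invr_gt0 //.
apply: ler_pM; rewrite ?mulr_ge0 ?nrm_ge0 ?invr_ge0 ?(ltW D0) //.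
  by rewrite ler_wpM2r ?nrm_ge0 //; apply: nrm_cexp_le => //;
    rewrite in_itv /= ler01 lexx.
by rewrite -[expR (2 * L)]invrK -expRN lef_pV2 ?posrE ?expR_gt0.
Qed.

Lemma rt_ge b (L : R) : nrm b <= L -> expR (- (2 * L)) <= rt b.
Proof.
move=> bL; rewrite ler_expR.
by have := normr_2Re_le bL; rewrite ler_norml => /andP[].
Qed.

Lemma E_ge b (L : R) : nrm b <= L -> expR (- (2 * L)) <= E b.
Proof.
move=> bL.
have i1 : (1 : R) \in `[0, 1] by rewrite in_itv /= ler01 lexx.
by have /andP[+ _] := prim_exp_bounds (normr_2Re_le bL) i1; rewrite mulr1.
Qed.

(** Induction on [n], with the hypothesis used at [M] because the edges below carry coefficients
    [theta l]. Nonnegativity of the slope keeps every denominator at least exp (- 2 L). *)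
Lemma dtn_bounded n (L : R) : exists2 K : R, 0 <= K &
  forall b, nrm b <= L -> nrm ((dtn n).1 b) <= K /\ 0 <= (dtn n).2 b <= K.
Proof.
elim: n L => [|n IH] L.
  exists (expR L * nrm 1 * expR (2 * L) + expR (2 * L)) => [|b bL].
    by rewrite addr_ge0 ?mulr_ge0 ?nrm_ge0 ?expR_ge0.
  have E0 : 0 < E b := prim_exp1_gt0 _.
  split.
    have -> : (dtn 0).1 b = cexp b 1 * 1 / (E b)%:C by rewrite mulr1.
    apply: le_trans (nrm_source_le _ bL (E_ge bL)) _.
    by rewrite lerDl expR_ge0.
  rewrite /= invr_ge0 (ltW E0) /=; apply: (@le_trans _ _ (expR (2 * L))).
    by rewrite -[expR (2 * L)]invrK -expRN lef_pV2 ?posrE ?expR_gt0 // E_ge.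
  by rewrite lerDr ?mulr_ge0 ?nrm_ge0 ?expR_ge0.
have [K K0 HK] := IH M.
have B0 : 0 <= vertex_slope n.
  apply: limr_ge.
    apply: (@weighted_series_cvg _ _ _ K) => // l.
    by have [_ /andP[b0 bK]] := HK _ (thetaM l); rewrite ger0_norm.
  near=> N; rewrite /series /= sumr_ge0 // => l _.
  by have [_ /andP[b0 bK]] := HK _ (thetaM l); rewrite mulr_ge0 // ltW.
exists (expR L * nrm (vertex_source n) * expR (2 * L) + vertex_slope n * expR (2 *
  L)) => [|b bL].
  by rewrite addr_ge0 ?mulr_ge0 ?nrm_ge0 ?expR_ge0.
have De : expR (- (2 * L)) <= rt b + E b * vertex_slope n.
  by apply: le_trans (rt_ge bL) _; rewrite lerDl mulr_ge0 // ltW // prim_exp1_gt0.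
have D0 := lt_le_trans (expR_gt0 _) De.
split.
  have -> : (dtn n.+1).1 b =
    cexp b 1 * vertex_source n / (rt b + E b * vertex_slope n)%:C by [].
  apply: le_trans (nrm_source_le _ bL De) _.
  by rewrite lerDl mulr_ge0 ?expR_ge0.
have -> : (dtn n.+1).2 b = vertex_slope n / (rt b + E b * vertex_slope n) by [].
rewrite divr_ge0 ?(ltW D0) //=; apply: (@le_trans _ _ (vertex_slope n * expR (2 * L))).
  apply: ler_wpM2l => //.
  by rewrite -[expR (2 * L)]invrK -expRN lef_pV2 ?posrE ?expR_gt0.
by rewrite lerDr ?mulr_ge0 ?nrm_ge0 ?expR_ge0.
Unshelve. all: by end_near.
Qed.

Lemma vertex_source_cvg n :
  series_cvg (fun l => (p l)%:C * (dtn n).1 (theta l)) (vertex_source n).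
Proof.
have [K K0 HK] := dtn_bounded n M.
by apply: (@weighted_series_sum _ _ _ K) => // l; have [] := HK _ (thetaM l).
Qed.

Lemma vertex_slope_cvg n :
  series (fun l => p l * (dtn n).2 (theta l)) @ \oo --> vertex_slope n.
Proof.
have [K K0 HK] := dtn_bounded n M.
apply: (@weighted_series_cvg _ _ _ K) => // l.
by have [_ /andP[b0 bK]] := HK _ (thetaM l); rewrite ger0_norm.
Qed.

Lemma vertex_slope_ge0 n : 0 <= vertex_slope n.
Proof.
have [K K0 HK] := dtn_bounded n M.
rewrite -(cvg_lim _ (vertex_slope_cvg (n:=n))) //; apply: limr_ge.
  by apply/cvg_ex; exists (vertex_slope n); exact: vertex_slope_cvg.
near=> N; rewrite /series /= sumr_ge0 // => l _.
by have [_ /andP[b0 bK]] := HK _ (thetaM l); rewrite mulr_ge0 // ltW.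
Unshelve. all: by end_near.
Qed.

(** Each term is a weighted y'(0) on an outgoing edge, written as (y' + b y)(0) - b y(0) with common
    vertex value [x]. The last sum is the one that [beta] compensates. *)
Lemma kirchhoff_sum n phi x :
  series_cvg
    (fun l => (p l)%:C * ((dtn n).1 (theta l) * phi - ((dtn n).2 (theta l))%:C * x
                          - theta l * x))
    (vertex_source n * phi - (vertex_slope n)%:C * x
      - series_sum (fun l => (p l)%:C * theta l) * x).
Proof.
have sA := series_cvgZ phi (vertex_source_cvg n).
have sB := series_cvgZ (- x) (series_cvg_real (vertex_slope_cvg (n:=n))).
have sT := series_cvgZ (- x) (weighted_series_sum p_gt0 p_cvg thetaM).
have := series_cvgD (series_cvgD sA sB) sT.
congr (series_cvg _ _); last by ring.
by apply/funext => l; rewrite rmorphM /=; ring.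
Qed.

End DirichletToNeumann.

(** * The tree *)

Section Tree.
Set Implicit Arguments.
Unset Strict Implicit.
Variables (T : nat) (k depth : nat -> nat).
Hypothesis hT : (2 <= T)%N.
Hypothesis htree : is_tree T k depth.
Implicit Types i j n m : nat.

(** * Tiers and the parent map *)

Lemma tree_parent_internal j : (2 <= j)%N -> internal T (k j).
Proof.
move=> j2; have j0 : (0 < j)%N by apply: leq_trans j2.
have [kj0|//] := tree_parent htree j0.
have : children k 0 j by [].
by rewrite (tree_children0 htree) => j1; move: j2; rewrite j1.
Qed.

Lemma internal_gt0 j : internal T j -> (0 < j)%N.
Proof. by rewrite /internal; case: ifP => _; [move=> /eqP ->|case: j]. Qed.

Lemma tree_parent_gt0 j : (2 <= j)%N -> (0 < k j)%N.
Proof. by move/tree_parent_internal/internal_gt0. Qed.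

(** The iterate following a 1 is [k 1 = 0], so positive iterates cannot run past a visit to 1. This
    pins down [depth]. *)
Lemma iter_depth_unique i m n : iter m k i = 1%N -> iter n k i = 1%N ->
  (forall l, (l < n)%N -> (0 < iter l k i)%N) -> (n <= m)%N.
Proof.
move=> im ini pos; rewrite leqNgt; apply/negP => mn.
have i0 : iter m.+1 k i = 0%N by rewrite iterS im (tree_root_edge htree).
move: mn; rewrite leq_eqVlt => /predU1P[nE|/pos]; last by rewrite i0.
by move: ini; rewrite -nE i0.
Qed.

Lemma depth1 : depth 1 = 0%N.
Proof.
have [d1 dpos] := tree_depth htree (isT : (0 < 1)%N).
by apply/eqP; rewrite -leqn0; apply: iter_depth_unique d1 dpos.
Qed.

Lemma depth_parent j : (2 <= j)%N -> depth j = (depth (k j)).+1.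
Proof.
move=> j2; have [dj dpos] := tree_depth htree (ltnW j2).
have [dk kpos] := tree_depth htree (tree_parent_gt0 j2).
apply/eqP; rewrite eqn_leq; apply/andP; split.
  by apply: iter_depth_unique dj dpos; rewrite iterSr.
case: (depth j) dj => [j1|d]; first by move: j2; rewrite -[j]/(iter 0 k j) j1.
by rewrite iterSr => dj; rewrite ltnS; apply: iter_depth_unique dj dk kpos.
Qed.

Lemma depth_eq0 j : (0 < j)%N -> depth j = 0%N -> j = 1%N.
Proof. by case: j => [|[|j]] // _; rewrite depth_parent. Qed.

Lemma internal_depth j : (0 < j)%N -> internal T j = ((depth j).+1 < T)%N.
Proof.
move=> j0; case: (boolP (internal T j)) => [/(tree_internal_tier htree)|nj].
  by case: T hT => // t _ /=.
have : leaf T j by rewrite /leaf j0.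
by move/(tree_leaf_tier htree) => ->; rewrite ltnn.
Qed.

Lemma depth_lt j : (0 < j)%N -> (depth j < T)%N.
Proof.
move=> j0; have := internal_depth j0;
  case: (boolP (internal T j)) => [_ /esym /ltnW //|nj _].
have : leaf T j by rewrite /leaf j0.
by move/(tree_leaf_tier htree) => <-.
Qed.

Lemma children_ge2 i j : internal T i -> children k i j -> (2 <= j)%N.
Proof.
move=> iT [j0 ki]; move: j0 ki; case: j => [|[|j]] // _;
  rewrite (tree_root_edge htree) => i0.
by have := internal_gt0 iT; rewrite -i0.
Qed.

Lemma tree_ind (P : nat -> Prop) :
  P 1%N -> (forall j, (2 <= j)%N -> P (k j) -> P j) -> forall j, (0 < j)%N -> P j.
Proof.
move=> P1 PS j; move dj : (depth j) => d; elim: d j dj => [|d IH] j dj j0.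
  by rewrite (depth_eq0 j0 dj).
have j2 : (2 <= j)%N by case: j dj j0 => [|[|j]] //; rewrite depth1.
apply: PS => //; apply: IH; last exact: tree_parent_gt0.
by move: dj; rewrite depth_parent // => -[].
Qed.

(** * Coefficients and summability of the weights *)

Variable R : realType.
Local Open Scope complex_scope.
Local Notation C := R[i].
Local Notation nrm := (@Normc.normc R).
Variables (nu : nat -> nat -> nat) (theta : nat -> C) (p : nat -> R)
  (b : nat -> C) (pt : nat -> R).
Hypothesis hcoef : is_coef T k nu theta p b pt.

Local Notation alpha := (alpha k depth pt).

Let p_gt0 : forall l, 0 < p l := coef_p_gt0 hcoef.

Let p_cvg : cvgn (series p).
Proof. by apply/cvg_ex; exists 1; exact: (coef_p_sum hcoef). Qed.

Lemma nuP i l : internal T i -> children k i (nu i l).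
Proof. by move=> /(coef_enum hcoef) [nuT _ _]; apply: nuT. Qed.

Lemma nu_ex j : (2 <= j)%N -> exists l, nu (k j) l = j.
Proof.
move=> j2; have [_ _ nuS] := coef_enum hcoef (tree_parent_internal j2).
have [|l _ lj] := nuS j; last by exists l.
by split => //; exact: ltnW.
Qed.

Lemma pt_gt0 j : (2 <= j)%N -> 0 < pt j.
Proof.
move=> j2; have [l {1}<-] := nu_ex j2.
by rewrite (coef_pt hcoef) ?tree_parent_internal.
Qed.

(** Every edge other than the first carries some [theta l]; the free value [b 1] enters through the
    maximum. *)
Lemma coef_bounded : exists M : R,
  (forall l, nrm (theta l) <= M) /\ (forall j, (0 < j)%N -> nrm (b j) <= M).
Proof.
have [M0 HM] := coef_theta_bounded hcoef.
have thM l : nrm (theta l) <= M0 by have := HM l; rewrite norm_nrm lecR.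
exists (Num.max M0 (nrm (b 1%N))); split=> [l|j j0]; first by rewrite le_max thM.
have [j2|] := leqP 2 j; last first.
  by case: j j0 => [|[|j]] // _ _; rewrite le_max lexx orbT.
have [l {1}<-] := nu_ex j2.
by rewrite (coef_b hcoef) ?tree_parent_internal // le_max thM.
Qed.

Lemma alpha1 : alpha 1 = 1.
Proof. by rewrite /alpha depth1 big_ord0. Qed.

Lemma alphaS j : (2 <= j)%N -> alpha j = pt j * alpha (k j).
Proof.
move=> j2; rewrite /alpha depth_parent // big_ord_recl; congr (_ * _).
by apply: eq_bigr => m _; rewrite -iterSr.
Qed.

Lemma alpha_gt0 j : (0 < j)%N -> 0 < alpha j.
Proof.
by move: j; apply: tree_ind => [|j j2 kj];
  rewrite ?alpha1 // alphaS // mulr_gt0 // pt_gt0.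
Qed.

Lemma sum_p_le1 n : \sum_(0 <= l < n) p l <= 1.
Proof.
have mono : nondecreasing_seq (series p).
  by apply: nondecreasing_series => l _ _; exact: ltW.
have -> : 1 = limn (series p) by apply/esym/cvg_lim => //; exact: (coef_p_sum hcoef).
exact: nondecreasing_cvgn_le.
Qed.

Lemma sum_p_uniq_le1 (s : seq nat) : uniq s -> \sum_(l <- s) p l <= 1.
Proof.
move=> us; pose L := (\max_(l <- s) l).+1.
apply: le_trans (sum_p_le1 L).
rewrite (perm_big [seq l <- index_iota 0 L | l \in s]).
  by rewrite big_filter big_mkcond; apply: ler_sum => l _; case: ifP => // _;
    exact: ltW.
apply: uniq_perm => //; first by rewrite filter_uniq // iota_uniq.
move=> l; rewrite mem_filter mem_index_iota /=; case: (boolP (l \in s)) => //= ls.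
by rewrite ltnS (@leq_bigmax_seq _ _ xpredT id).
Qed.

Lemma sum_children_le1 i n : internal T i ->
  \sum_(1 <= j < n | k j == i) pt j <= 1.
Proof.
move=> iT; have [_ nuI nuS] := coef_enum hcoef iT.
(* [g] inverts the enumeration of the children of [i] (with default 0 elsewhere), turning the sum
   into one of [p] over distinct indices. *)
have /choice [g gP] : forall j, exists l, children k i j -> nu i l = j.
  move=> j; have [cj|ncj] := pselect (children k i j); last by exists 0%N.
  by have [l _ lj] := nuS j cj; exists l.
pose F := [seq j <- index_iota 1 n | k j == i].
have FP j : j \in F -> children k i j.
  by rewrite mem_filter mem_index_iota => /and3P[/eqP kj j1 _].
rewrite -big_filter -/F (eq_big_seq (fun j => p (g j))); last first.
  by move=> j /FP /gP {1}<-; rewrite (coef_pt hcoef).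
rewrite -(big_map g xpredT p); apply: sum_p_uniq_le1.
rewrite map_inj_in_uniq ?filter_uniq ?iota_uniq //.
by move=> x y /FP /gP {2}<- /FP /gP {2}<- ->.
Qed.

(** Induction on the tier: by [alphaS], grouping the edges by parent leaves the weights of the tier
    above, each times a partial sum of [pt] that is at most 1. *)
Lemma sum_tier_le1 d n : \sum_(1 <= j < n | depth j == d) alpha j <= 1.
Proof.
elim: d n => [|d IH] n.
  apply: (@le_trans _ _ (\sum_(1 <= j < n | j == 1%N) alpha j)).
    rewrite big_nat_cond [leRHS]big_nat_cond le_eqVlt; apply/orP; left; apply/eqP;
      apply: eq_bigl => j.
    apply/andP/andP => -[/andP[j1 jn] /eqP dj]; split; rewrite ?j1 //.
      by rewrite (depth_eq0 j1 dj).
    by rewrite dj depth1.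
  by rewrite big_nat1_eq; case: ifP => // _; rewrite alpha1.
(* Exceeds the parent of every index below [n], so the truncated tier has all its parents below
   [N]. *)
pose N := (\max_(j <- index_iota 1 n) k j).+1.
apply: le_trans (IH N).
have -> : \sum_(1 <= j < n | depth j == d.+1) alpha j =
    \sum_(1 <= j < n | depth j == d.+1) \sum_(1 <= i < N | k j == i) pt j * alpha i.
  rewrite big_nat_cond [RHS]big_nat_cond;
    apply: eq_bigr => j /andP[/andP[j1 jn] /eqP dj].
  have j2 : (2 <= j)%N by case: j dj j1 {jn} => [|[|j]] //; rewrite depth1.
  under eq_bigl do rewrite eq_sym.
  rewrite big_nat1_eq tree_parent_gt0 // alphaS // ifT //.
  by rewrite ltnS (@leq_bigmax_seq _ _ xpredT k) // mem_index_iota j1.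
rewrite (exchange_big_dep_nat xpredT)
  //= [leRHS]big_mkcond big_nat_cond [leRHS]big_nat_cond.
apply: ler_sum => i /andP[/andP[i1 _] _].
have child j : (1 <= j < n)%N && ((depth j == d.+1) && (k j == i)) ->
    [/\ (2 <= j)%N, internal T i & depth i = d].
  move=> /andP[/andP[j1 _] /andP[/eqP dj /eqP kj]].
  have j2 : (2 <= j)%N by case: j dj j1 {kj} => [|[|j]] //; rewrite depth1.
  split => //; first by rewrite -kj tree_parent_internal.
  by move: dj; rewrite depth_parent // kj => -[].
have [/andP[/eqP id iT]|idN] := boolP ((depth i == d) && internal T i); last first.
  rewrite big_nat_cond big_pred0 => [|j]; last first.
    apply/negP => /child [_ iT id]; move: idN; rewrite id iT eqxx //.
  by case: ifP => // _; exact/ltW/alpha_gt0.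
rewrite id eqxx -big_distrl /= ler_piMl //; first exact/ltW/alpha_gt0.
apply: le_trans (sum_children_le1 n iT).
rewrite big_nat_cond [leRHS]big_nat_cond big_mkcond [leRHS]big_mkcond /=.
apply: ler_sum => j _; case: ifP => [/andP[-> /andP[_ ->]] //|_].
case: ifP => // /andP[/andP[j1 _] /eqP kj].
by rewrite ltW // pt_gt0 // (children_ge2 iT).
Qed.

Lemma sum_alpha_le n : \sum_(1 <= j < n) alpha j <= T%:R.
Proof.
have -> : \sum_(1 <= j < n) alpha j =
    \sum_(1 <= j < n) \sum_(0 <= d < T | depth j == d) alpha j.
  apply: eq_big_nat => j /andP[j1 _]; under eq_bigl do rewrite eq_sym.
  by rewrite big_nat1_eq depth_lt.
rewrite (exchange_big_dep_nat xpredT) //=.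
apply: (@le_trans _ _ (\sum_(0 <= d < T) (1 : R)));
  last by rewrite big_const_nat subn0 iter_addr_0.
by apply: ler_sum => d _; exact: sum_tier_le1.
Qed.

(** Each edge contributes at most its weight times (s + 1) K, and the T tiers have total weight at
    most T. *)
Lemma sqnormW_le s r (y : nat -> sobolev R r) (K : R) : 0 <= K ->
  (forall j m, (0 < j)%N -> (m <= s)%N -> (sqnormL2 (y j m) <= K%:E)%E) ->
  (sqnormW alpha s y <= (T%:R * (s.+1%:R * K))%:E)%E.
Proof.
move=> K0 yK; rewrite /sqnormW.
have L0 j m : (0 <= sqnormL2 (y j m))%E.
  by apply: integral_ge0 => t _; rewrite lee_fin sqmod_nrm sqr_ge0.
have t0 j : (1 <= j)%N -> (0 <= (alpha j)%:E * \sum_(m < s.+1) sqnormL2 (y j m))%E.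
  by move=> j1; rewrite mule_ge0 ?lee_fin ?(ltW (alpha_gt0 j1)) // sume_ge0.
apply: lime_le; first by apply: is_cvg_nneseries => j j1 _; exact: t0.
near=> n.
apply: (@le_trans _ _ (\sum_(1 <= j < n) (alpha j * (s.+1%:R * K))%:E)%E).
  rewrite big_nat_cond [leRHS]big_nat_cond; apply: lee_sum => j /andP[/andP[j1 _] _].
  rewrite EFinM lee_wpmul2l ?lee_fin ?(ltW (alpha_gt0 j1)) //.
  apply: (@le_trans _ _ (\sum_(m < s.+1) K%:E)%E); first by apply: lee_sum => m _;
    apply: yK => //; rewrite -ltnS ltn_ord.
  by rewrite sumEFin lee_fin sumr_const card_ord mulr_natl.
by rewrite sumEFin lee_fin -mulr_suml ler_wpM2r ?sum_alpha_le ?mulr_ge0.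
Unshelve. all: by end_near.
Qed.

(** * Reduction of the problem to the starting values *)

Lemma theta_series_sum i : internal T i ->
  series_sum (fun l => (pt (nu i l))%:C * b (nu i l)) =
  series_sum (fun l => (p l)%:C * theta l).
Proof.
move=> iT; congr series_sum; apply/funext => l.
by rewrite (coef_pt hcoef) // (coef_b hcoef).
Qed.

(** The number of tiers below the edge [j], that is, the index at which [dtn] is taken: 0 at the
    leaves. *)
Let level j := (T.-1 - depth j)%N.

Let level_internal j : (0 < j)%N -> internal T j -> exists n, level j = n.+1.
Proof.
move=> j0; rewrite internal_depth // => dj.
by exists (level j).-1; rewrite prednK // subn_gt0 ltn_predRL.
Qed.

Let level_child i j : internal T i -> children k i j -> level i = (level j).+1.
Proof.
move=> iT ij; have j2 := children_ge2 iT ij; have [j0 ki] := ij.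
rewrite /level (depth_parent j2) ki subnS prednK // subn_gt0 ltn_predRL.
by rewrite -internal_depth // internal_gt0.
Qed.

Let level_leaf j : leaf T j -> level j = 0%N.
Proof. by move/(tree_leaf_tier htree) => dT; rewrite /level -dT subnn. Qed.

(** The value of (y' + b y)(0) on the edge [j], rather than of y'(0), forced by y(0) = [x] and the
    leaf value [phi]. *)
Definition edge_slope phi j (x : C) : C :=
  (dtn theta p (level j)).1 (b j) * phi - ((dtn theta p (level j)).2 (b j))%:C * x.

Lemma solves_B_edge phi0 phi1 (y : nat -> sobolev R 2) j :
  solves_B T k nu b pt phi0 phi1 y -> (0 < j)%N ->
  let w := edge_slope phi1 j (y j 0%N 0) in forall t : R, t \in `[0, 1] ->
  y j 0%N t = edge (b j) (y j 0%N 0) w t /\ y j 1%N t = edge1 (b j) (y j 0%N 0) w t.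
Proof.
move=> sy; move: j; have [M [thM bM]] := coef_bounded.
have i1 : (1 : R) \in `[0, 1] by rewrite in_itv /= ler01 lexx.
(* The shape of the solution on an edge is known; only its parameter w has to be identified, by
   induction on the level from the leaves up. *)
suff H n j : (0 < j)%N -> level j = n ->
    y j 1%N 0 + b j * y j 0%N 0 = edge_slope phi1 j (y j 0%N 0).
  move=> j j0 w; rewrite /w -(H _ j j0 erefl).
  exact: sobolev_edge (B_equation sy j0).
elim: n j => [|n IH] j j0 ljn; rewrite /edge_slope ljn;
  have [yj1 y'j1] := sobolev_edge (B_equation sy j0) i1.
  apply/(edge_leaf theta p); rewrite -yj1; apply: (B_leaf sy).
  rewrite /leaf j0; apply/negP => /(level_internal j0) [m]; by rewrite ljn.
have jT : internal T j.
  apply: contraT => jT; have : leaf T j by rewrite /leaf j0.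
  by move/level_leaf; rewrite ljn.
set w := y j 1%N 0 + _.
apply/(edge_internal _ _ _ _ (vertex_slope_ge0 p_gt0 p_cvg thM n)).
have : w * cexp (b j)^*%C 1 = y j 1%N 1 + b j * y j 0%N 1.
  by rewrite y'j1 yj1 /edge1 -/w; ring.
move=> ->.
have K1 := B_kirchhoff sy jT.
have := kirchhoff_sum p_gt0 p_cvg thM n phi1 (y j 0%N 1).
(* The children lie one level lower and start from y_j(1), so the induction hypothesis gives their
   derivatives at 0. The two limits of the same series must then agree. *)
have -> : (fun l => (p l)%:C * ((dtn theta p n).1 (theta l) * phi1
      - ((dtn theta p n).2 (theta l))%:C * y j 0%N 1 - theta l * y j 0%N 1)) =
    (fun l => (pt (nu j l))%:C * y (nu j l) 1%N 0).
  apply/funext => l; have cl := nuP l jT; have c2 := children_ge2 jT cl.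
  have [c0 kc] := cl.
  have lc : level (nu j l) = n by have := level_child jT cl; rewrite ljn => -[].
  have xc : y (nu j l) 0%N 0 = y j 0%N 1 by rewrite -(B_continuity sy c2) kc.
  have := IH _ c0 lc; rewrite /edge_slope lc xc (coef_b hcoef) // => <-.
  by rewrite (coef_pt hcoef) // addrK.
move=> K2; have := series_cvg_unique K1 K2.
rewrite /beta theta_series_sum // -yj1 => E.
transitivity (y j 1%N 1 + (b j - series_sum (fun l => (p l)%:C * theta l)) * y j 0%N 1
  + series_sum (fun l => (p l)%:C * theta l) * y j 0%N 1); first by ring.
by rewrite E; ring.
Qed.

(** What the root condition and continuity demand of the values y_j(0): a recursion from the root
    down, to which the whole problem reduces. *)
Record edge_starts phi0 phi1 (x : nat -> C) : Prop := EdgeStarts {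
  edge_starts1 : x 1%N = phi0;
  edge_startsS : forall j, (2 <= j)%N ->
    x j = edge (b (k j)) (x (k j)) (edge_slope phi1 (k j) (x (k j))) 1 }.

Lemma solves_B_edge_starts phi0 phi1 (y : nat -> sobolev R 2) :
  solves_B T k nu b pt phi0 phi1 y -> edge_starts phi0 phi1 (fun j => y j 0%N 0).
Proof.
move=> sy; split=> [|j j2]; first exact: (B_root sy).
have i1 : (1 : R) \in `[0, 1] by rewrite in_itv /= ler01 lexx.
by rewrite -(B_continuity sy j2); have [] := solves_B_edge sy (tree_parent_gt0 j2) i1.
Qed.

Lemma edge_starts_unique phi0 phi1 x z :
  edge_starts phi0 phi1 x -> edge_starts phi0 phi1 z ->
  forall j, (0 < j)%N -> x j = z j.
Proof.
move=> [x1 xS] [z1 zS]; apply: tree_ind => [|j j2 xz]; first by rewrite x1 z1.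
by rewrite xS // zS // xz.
Qed.

Lemma edge_starts_ex phi0 phi1 : exists x, edge_starts phi0 phi1 x.
Proof.
(* The depth serves as fuel, since the recursion through [k] is not structural in [j]. *)
pose fix xv d j {struct d} : C := if d is d'.+1 then
  edge (b (k j)) (xv d' (k j)) (edge_slope phi1 (k j) (xv d' (k j))) 1 else phi0.
exists (fun j => xv (depth j) j); split=> [|j j2]; first by rewrite depth1.
by rewrite {1}depth_parent.
Qed.

Lemma edge_starts_solves_B phi0 phi1 x : edge_starts phi0 phi1 x ->
  solves_B T k nu b pt phi0 phi1
    (fun j => edge_sobolev (b j) (x j) (edge_slope phi1 j (x j))).
Proof.
move=> [x1 xS]; have [M [thM bM]] := coef_bounded; split.
- by move=> j j0; apply: aeW => t _; exact: edge_equation.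
- by rewrite /= edge_0.
- by move=> j j2; rewrite /= edge_0 (xS _ j2).
- move=> j jl; apply/(edge_leaf theta p).
  by rewrite /edge_slope level_leaf.
move=> j jT; rewrite /beta theta_series_sum //=.
have j0 := internal_gt0 jT.
have [n ljn] := level_internal j0 jT.
set X := edge (b j) _ _ 1.
have := kirchhoff_sum p_gt0 p_cvg thM n phi1 X.
congr series_cvg.
  apply/funext => l; have cl := nuP l jT; have c2 := children_ge2 jT cl.
  have [c0 kc] := cl.
  have lc : level (nu j l) = n by have := level_child jT cl; rewrite ljn => -[].
  have xc : x (nu j l) = X by rewrite xS // kc.
  by rewrite edge1_0 /edge_slope lc xc (coef_b hcoef) // (coef_pt hcoef).
(* Unfolding only one side of this identity gives the form that [edge_internal] converts into the
   condition at the vertex. *)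
have wE : edge_slope phi1 j (x j) = edge_slope phi1 j (x j) by [].
move: wE; rewrite {2}/edge_slope ljn =>
  /(edge_internal _ _ _ _ (vertex_slope_ge0 p_gt0 p_cvg thM n)).
by rewrite -/X /edge1 -/X => ->; ring.
Qed.

(** * Uniform bounds, well-posedness and the norm estimate *)

Lemma edge_starts_bounded : exists2 K : R, 0 <= K &
  forall phi0 phi1 x, edge_starts phi0 phi1 x -> forall j, (0 < j)%N ->
    nrm (x j) + nrm (edge_slope phi1 j (x j)) <= K * (nrm phi0 + nrm phi1).
Proof.
have [M [thM bM]] := coef_bounded.
have i1 : (1 : R) \in `[0, 1] by rewrite in_itv /= ler01 lexx.
(* On a fixed tier, a bound [L] for the starting value yields one for w through the bounded
   coefficients of [dtn]. *)
have slope d : exists2 K : R, 0 <= K & forall phi0 phi1 (x : C) j (L : R), (0 < j)%N ->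
    depth j = d -> 0 <= L -> nrm x <= L * (nrm phi0 + nrm phi1) ->
    nrm x + nrm (edge_slope phi1 j x) <= (L + K * (1 + L)) * (nrm phi0 + nrm phi1).
  have [K K0 HK] := dtn_bounded p_gt0 p_cvg thM (T.-1 - d) M.
  exists K => // phi0 phi1 x j L j0 dj L0 xL.
  have [aK /andP[b0 bK]] := HK _ (bM j j0).
  rewrite mulrDl lerD //.
  apply: le_trans (nrmD _ _) _;
    rewrite nrmN (nrmM _ phi1) (nrmM _ x) nrm_real ger0_norm; last by rewrite /level dj.
  rewrite /level dj; set N := nrm phi0 + nrm phi1.
  have -> : K * (1 + L) * N = K * N + K * (L * N) by ring.
  by apply: lerD; apply: ler_pM; rewrite ?nrm_ge0 // lerDr nrm_ge0.
have [Ke Ke0 HKe] := edge_der_bounded M.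
(* Each further tier enlarges the constant independently of the edge and the data; as depths stay
   below [T], finitely many steps reach all edges. *)
have H d : exists2 K : R, 0 <= K & forall phi0 phi1 x, edge_starts phi0 phi1 x ->
    forall j, (0 < j)%N -> (depth j <= d)%N ->
    nrm (x j) + nrm (edge_slope phi1 j (x j)) <= K * (nrm phi0 + nrm phi1).
  elim: d => [|d [L L0 IH]].
    have [K K0 HK] := slope 0%N.
    exists (1 + K * (1 + 1)) => [|phi0 phi1 x [x1 _] j j0].
      by rewrite addr_ge0 ?mulr_ge0.
    rewrite leqn0 => /eqP dj; have j1 := depth_eq0 j0 dj.
    by apply: HK => //; rewrite mul1r j1 x1 lerDl nrm_ge0.
  have [K K0 HK] := slope d.+1.
  have KL0 : 0 <= Ke * L by rewrite mulr_ge0.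
  have S0 : 0 <= Ke * L + K * (1 + Ke * L) by rewrite addr_ge0 ?mulr_ge0 // addr_ge0.
  exists (L + (Ke * L + K * (1 + Ke * L))) => [|phi0 phi1 x ex j j0];
    first by rewrite addr_ge0.
  have N0 : 0 <= nrm phi0 + nrm phi1 by rewrite addr_ge0 ?nrm_ge0.
  rewrite leq_eqVlt => /predU1P[dj|]; last first.
    rewrite ltnS => /(IH _ _ _ ex _ j0) /le_trans; apply.
    by rewrite ler_wpM2r // lerDl.
  apply: (@le_trans _ _ ((Ke * L + K * (1 + Ke * L)) * (nrm phi0 + nrm phi1)));
    last first.
    by rewrite ler_wpM2r // lerDr.
  have j2 : (2 <= j)%N by case: j dj j0 => [|[|j]] //; rewrite depth1.
  apply: HK => //; rewrite (edge_startsS ex j2) -mulrA.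
  have kj0 := tree_parent_gt0 j2.
  apply: le_trans (HKe 0%N _ _ _ _ (bM _ kj0) i1) _; rewrite ler_wpM2l //.
  apply: IH => //.
  by move: dj; rewrite depth_parent // => -[->].
have [K K0 HK] := H T; exists K => // phi0 phi1 x ex j j0.
by apply: HK => //; apply: ltnW; exact: depth_lt.
Qed.

(** The starting values of both solutions obey the same recursion, and they determine the solution
    on every edge. *)
Lemma solves_B_unique phi0 phi1 (y z : nat -> sobolev R 2) :
  solves_B T k nu b pt phi0 phi1 y -> solves_B T k nu b pt phi0 phi1 z ->
  same_tuple y z.
Proof.
move=> sy sz j t j0 t01.
have [-> _] := solves_B_edge sy j0 t01; have [-> _] := solves_B_edge sz j0 t01.
by rewrite (edge_starts_unique (solves_B_edge_starts sy) (solves_B_edge_starts sz) j0).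
Qed.

Lemma solves_B_ex phi0 phi1 : exists2 y : nat -> sobolev R 2,
  inW alpha y & solves_B T k nu b pt phi0 phi1 y.
Proof.
have [x ex] := edge_starts_ex phi0 phi1.
have [M [_ bM]] := coef_bounded; have [Ke Ke0 HKe] := edge_der_bounded M.
have [K K0 HK] := edge_starts_bounded.
exists (fun j => edge_sobolev (b j) (x j) (edge_slope phi1 j (x j))); last first.
  exact: edge_starts_solves_B.
(* Bounds the squared L_2 norm of each derivative on each edge; the factor 3 below counts the orders
   0, 1, 2. *)
pose B := (Ke * (K * (nrm phi0 + nrm phi1))) ^+ 2.
apply: (@le_lt_trans _ _ (sqrte (T%:R * (3%:R * B))%:E)); last exact: ltry.
have B0 : 0 <= T%:R * (3%:R * B).
  exact: mulr_ge0 (ler0n _ _) (mulr_ge0 (ler0n _ _) (sqr_ge0 _)).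
rewrite lee_sqrt ?lee_fin //; apply: sqnormW_le => [|j m j0 m2]; first exact: sqr_ge0.
have [mR mI _] := inL2_edge_der m (b j) (x j) (edge_slope phi1 j (x j)).
apply: sqnormL2_le => // t t01; apply: le_trans (HKe _ _ _ _ _ (bM _ j0) t01) _.
by rewrite ler_wpM2l // HK.
Qed.

Lemma solves_B_normW1 : exists K : R, forall phi0 phi1 (y : nat -> sobolev R 2),
  solves_B T k nu b pt phi0 phi1 y ->
  (normW alpha 1 y <= (K * (nrm phi0 + nrm phi1))%:E)%E.
Proof.
have [M [_ bM]] := coef_bounded; have [Ke Ke0 HKe] := edge_der_bounded M.
have [K K0 HK] := edge_starts_bounded.
(* The squared norm is at most 2 T Q^2 with Q = Ke K N; as 2 T >= 1, this is at most (2 T Q)^2,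
   which avoids a square root in the constant. *)
exists (2 * T%:R * (Ke * K)) => phi0 phi1 y sy; set N := nrm phi0 + nrm phi1.
have N0 : 0 <= N by rewrite addr_ge0 ?nrm_ge0.
have C0 : 0 <= 2 * T%:R * (Ke * K) * N by rewrite !mulr_ge0.
rewrite -[leRHS]gee0_abs ?lee_fin // -sqrte_sqr lee_sqrt ?sqre_ge0 // -EFin_expe.
apply: (@le_trans _ _ (T%:R * (2%:R * (Ke * (K * N)) ^+ 2))%:E).
  apply: sqnormW_le => [|j m j0 m1]; first exact: sqr_ge0.
  have [mR mI _] := @sobolev_L2 _ _ (y j) m (leqW m1).
  apply: sqnormL2_le => // t t01.
  have yE : y j m t = edge_der m (b j) (y j 0%N 0) (edge_slope phi1 j (y j 0%N 0)) t.
    by have [y0 y1] := solves_B_edge sy j0 t01; case: m m1 {mR mI} => [|[|]].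
  rewrite yE; apply: le_trans (HKe _ _ _ _ _ (bM _ j0) t01) _.
  by rewrite ler_wpM2l // (HK _ _ _ (solves_B_edge_starts sy)).
rewrite lee_fin; have T1 : 1 <= T%:R :> R by rewrite ler1n; case: T hT.
set Q := Ke * (K * N).
have -> : (2 * T%:R * (Ke * K) * N) ^+ 2 = (2 * T%:R) * (T%:R * (2%:R * Q ^+ 2)).
  by rewrite /Q; ring.
by rewrite ler_peMl ?mulr_ge0 ?sqr_ge0 //; lra.
Qed.

End Tree.

Theorem mainTheorem3 (R : realType) (T : nat) (k depth : nat -> nat)
    (nu : nat -> nat -> nat) (theta : nat -> R[i]) (p : nat -> R)
    (b : nat -> R[i]) (pt : nat -> R)
    (hT : (2 <= T)%N)
    (htree : is_tree T k depth)
    (hcoef : is_coef T k nu theta p b pt) :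
  (forall phi0 phi1 : R[i],
     exists y : nat -> sobolev R 2,
       [/\ inW (alpha k depth pt) y,
           solves_B T k nu b pt phi0 phi1 y &
           forall z : nat -> sobolev R 2,
             inW (alpha k depth pt) z ->
             solves_B T k nu b pt phi0 phi1 z ->
             same_tuple y z]) /\
  (exists C : R,
     forall (phi0 phi1 : R[i]) (y : nat -> sobolev R 2),
       inW (alpha k depth pt) y ->
       solves_B T k nu b pt phi0 phi1 y ->
       (normW (alpha k depth pt) 1 y <=
          (C * (complex.Re `|phi0| + complex.Re `|phi1|))%:E)%E).
Proof.
split=> [phi0 phi1|].
  have [y yW sy] := solves_B_ex hT htree hcoef phi0 phi1.
  exists y; split=> // z _ sz; exact: (solves_B_unique hT htree hcoef sy sz).
have [K HK] := solves_B_normW1 hT htree hcoef.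
by exists K => phi0 phi1 y _ sy; rewrite !Re_normc; exact: HK sy.
Qed.
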